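(* For every $\lambda_\oplus$-term $M$, $\mathcal T(\mathrm{BT}(M))=\mathrm{NF}(\mathcal T(M))$.
   Context: $\lambda_\oplus$-terms are given by $M,N,P,Q ::= x\mid\lambda x.M\mid MN\mid M\oplus N$, up to renaming of bound variables; $M[N/x]$ is capture-avoiding substitution; application associates to the left; $\lambda\vec x$ is a possibly empty sequence of abstractions. The hereditary head reduction $L$ on $\lambda_\oplus$-terms: $L(M\oplus N)=L(M)\oplus L(N)$; $L(\lambda\vec x.\lambda y.(M\oplus N))=\lambda\vec x.(\lambda y.M\oplus\lambda y.N)$; $L(\lambda\vec x.(M\oplus N)PQ_1\cdots Q_k)=\lambda\vec x.(MP\oplus NP)Q_1\cdots Q_k$; $L(\lambda\vec x.yQ_1\cdots Q_k)=\lambda\vec x.y\,L(Q_1)\cdots L(Q_k)$; $L(\lambda\vec x.(\lambda y.M)NQ_1\cdots Q_k)=\lambda\vec x.M[N/y]Q_1\cdots Q_k$ ($k\ge0$). Approximants: the same grammar with a constant $\bot$; $\le$ is the least preorder with $\bot\le M$ and compatible with constructors. Elementary Böhm trees $\mathcal N$: least set containing $\bot$, $\lambda\vec x.xN_1\cdots N_n$ for $N_i\in\mathcal N$, and $N_1\oplus N_2$ for $N_1,N_2\in\mathcal N$. $\mathrm{eBT}(M\oplus N)=\mathrm{eBT}(M)\oplus\mathrm{eBT}(N)$, $\mathrm{eBT}(\lambda\vec x.xQ_1\cdots Q_k)=\lambda\vec x.x\,\mathrm{eBT}(Q_1)\cdots\mathrm{eBT}(Q_k)$, $\mathrm{eBT}(M)=\bot$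 otherwise. $\mathrm{BT}(M)=\{N\in\mathcal N\mid\exists n,\ N\le\mathrm{eBT}(L^n(M))\}$. Resource terms and monomials: $s,t ::= x\mid\lambda x.s\mid\langle s\rangle\bar t\mid s\oplus\bullet\mid\bullet\oplus s$, $\bar t::=[t_1,\dots,t_n]$ (finite multisets). Finite formal sums with coefficients in $\mathbb N$ with supports $\mathrm{supp}(E)$; constructors extended by multilinearity. For $\bar u=[u_1,\dots,u_n]$, the symmetric multilinear substitution $\partial_xe\cdot\bar u$: $\partial_xy\cdot\bar u$ is $y$ if $y\ne x$ and $n=0$, $u_1$ if $y=x$ and $n=1$, $0$ otherwise; it commutes with $\lambda y.$ ($y$ fresh), $-\oplus\bullet$ and $\bullet\oplus-$; $\partial_x(\langle s\rangle\bar t)\cdot\bar u=\sum_{(I_1,I_2)}\langle\partial_xs\cdot\bar u_{I_1}\rangle(\partial_x\bar t\cdot\bar u_{I_2})$ and $\partial_x[t_1,\dots,t_k]\cdot\bar u=\sum_{(I_1,\dots,I_k)}[\partial_xt_1\cdot\bar u_{I_1},\dots,\partial_xt_k\cdot\bar u_{I_k}]$, sums over tuples of pairwise disjoint possibly empty subsets of $\{1,\dots,n\}$ covering it, $\bar u_I=[u_i\mid i\in I]$. The reduction $\to_\partial$ is generated by $\langle\lambda x.s\rangle\bar t\to_\partial\partial_xs\cdot\bar t$, $\langle s\oplus\bullet\rangle\bar t\to_\partial(\langle s\rangle\bar t)\oplus\bullet$, $\langle\bullet\oplus s\rangle\bar t\to_\partial\bullet\oplus\langle s\rangle\bar t$,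 $\lambda x.(s\oplus\bullet)\to_\partial(\lambda x.s)\oplus\bullet$, $\lambda x.(\bullet\oplus s)\to_\partial\bullet\oplus\lambda x.s$, closed under all contexts and extended to sums by $e+F\to_\partial E'+F$ when $e\to_\partial E'$; it is confluent and strongly normalizing, with normal form $\mathrm{NF}(E)$. For a set $E$ of resource terms, $\mathrm{NF}(E)=\bigcup_{e\in E}\mathrm{supp}(\mathrm{NF}(e))$. The Taylor support of approximants is defined by $\mathcal T(\bot)=\emptyset$, $\mathcal T(x)=\{x\}$, $\mathcal T(\lambda x.N)=\{\lambda x.t\mid t\in\mathcal T(N)\}$, $\mathcal T(PQ)=\{\langle s\rangle[t_1,\dots,t_n]\mid n\ge0,\ s\in\mathcal T(P),\ t_i\in\mathcal T(Q)\}$, $\mathcal T(P\oplus Q)=\{s\oplus\bullet\mid s\in\mathcal T(P)\}\cup\{\bullet\oplus t\mid t\in\mathcal T(Q)\}$; and $\mathcal T(\mathrm{BT}(M))=\bigcup_{B\in\mathrm{BT}(M)}\mathcal T(B)$. *)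

(* Defs.v *)
From Stdlib Require Import Arith List Relations RelationClasses SetoidPermutation.
Import ListNotations.

(** Terms are taken up to renaming of bound variables by using de Bruijn
    indices; free variables are the indices that exceed the binding depth. *)
Inductive term : Type :=
| Var (x : nat)
| Lam (M : term)
| App (M N : term)
| Plus (M N : term).

Definition shift_var (c x : nat) : nat := if x <? c then x else S x.

Fixpoint lift (c : nat) (M : term) : term :=
  match M with
  | Var x => Var (shift_var c x)
  | Lam M => Lam (lift (S c) M)
  | App M N => App (lift c M) (lift c N)
  | Plus M N => Plus (lift c M) (lift c N)
  end.

(** [subst k N M] removes the variable [k] from the context of [M]: indices
    above [k] are decremented. *)
Fixpoint subst (k : nat) (N M : term) : term :=
  match M with
  | Var x =>
      match Nat.compare x k with
      | Lt => Var x
      | Eq => N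
      | Gt => Var (pred x)
      end
  | Lam M => Lam (subst (S k) (lift 0 N) M)
  | App P Q => App (subst k N P) (subst k N Q)
  | Plus P Q => Plus (subst k N P) (subst k N Q)
  end.

Definition lams (n : nat) (M : term) : term := Nat.iter n Lam M.
Definition apps (M : term) (Qs : list term) : term := fold_left App Qs M.

(** [neutral M]: [M] is of the form [apps (Var x) Qs].
    [hnf M]: [M] is of the form [lams n (apps (Var x) Qs)]. *)
Fixpoint neutral (M : term) : bool :=
  match M with
  | Var _ => true
  | App P _ => neutral P
  | _ => false
  end.

Fixpoint hnf (M : term) : bool :=
  match M with
  | Lam M => hnf M
  | _ => neutral M
  end.

(** Hereditary head reduction, in a structurally recursive form; the lemmas
    [head_red_*] below are its defining equations. *)
Fixpoint head_red (M : term) : term :=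
  match M with
  | Var x => Var x
  | Plus M N => Plus (head_red M) (head_red N)
  | Lam (Plus M N) => Plus (Lam M) (Lam N)
  | Lam M => Lam (head_red M)
  | App (Plus M N) P => Plus (App M P) (App N P)
  | App (Lam M) N => subst 0 N M
  | App P Q => App (head_red P) (if neutral P then head_red Q else Q)
  end.

Inductive approx : Type :=
| ABot
| AVar (x : nat)
| ALam (M : approx)
| AApp (M N : approx)
| APlus (M N : approx).

Definition alams (n : nat) (M : approx) : approx := Nat.iter n ALam M.
Definition aapps (M : approx) (Qs : list approx) : approx := fold_left AApp Qs M.

Fixpoint approx_of_term (M : term) : approx :=
  match M with
  | Var x => AVar x
  | Lam M => ALam (approx_of_term M)
  | App M N => AApp (approx_of_term M) (approx_of_term N)
  | Plus M N => APlus (approx_of_term M) (approx_of_term N)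
  end.

Coercion approx_of_term : term >-> approx.

Inductive approx_le : approx -> approx -> Prop :=
| le_refl M : approx_le M M
| le_trans M N P : approx_le M N -> approx_le N P -> approx_le M P
| le_bot M : approx_le ABot M
| le_lam M M' : approx_le M M' -> approx_le (ALam M) (ALam M')
| le_app M M' N N' :
    approx_le M M' -> approx_le N N' -> approx_le (AApp M N) (AApp M' N')
| le_plus M M' N N' :
    approx_le M M' -> approx_le N N' -> approx_le (APlus M N) (APlus M' N').

Inductive elementary : approx -> Prop :=
| elem_bot : elementary ABot
| elem_hnf n x Ns :
    Forall elementary Ns -> elementary (alams n (aapps (AVar x) Ns))
| elem_plus N1 N2 :
    elementary N1 -> elementary N2 -> elementary (APlus N1 N2).

(** The lemmas [eBT_*] below are the defining equations of [eBT]. *)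
Fixpoint eBT (M : term) : approx :=
  match M with
  | Var x => AVar x
  | Plus M N => APlus (eBT M) (eBT N)
  | Lam P => if hnf P then ALam (eBT P) else ABot
  | App P Q => if neutral P then AApp (eBT P) (eBT Q) else ABot
  end.

Definition BT (M : term) (N : approx) : Prop :=
  elementary N /\ exists n, approx_le N (eBT (Nat.iter n head_red M)).

(** These are representatives: bags are lists, and resource terms proper are
    the classes modulo [req], the hereditary permutation of bags. Sets of
    resource terms are [req]-invariant predicates.
    [RInl s] and [RInr s] stand for [s ⊕ •] and [• ⊕ s]. *)
Inductive rterm : Type :=
| RVar (x : nat)
| RLam (s : rterm)
| RApp (s : rterm) (ts : list rterm)
| RInl (s : rterm)
| RInr (s : rterm).

Inductive req : rterm -> rterm -> Prop :=
| req_var x : req (RVar x) (RVar x)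
| req_lam s s' : req s s' -> req (RLam s) (RLam s')
| req_app s s' ts ts' :
    req s s' -> PermutationA req ts ts' -> req (RApp s ts) (RApp s' ts')
| req_inl s s' : req s s' -> req (RInl s) (RInl s')
| req_inr s s' : req s s' -> req (RInr s) (RInr s').

(** A finite formal sum with coefficients in [nat] is the list of its terms,
    repeated according to their coefficients, modulo [rsum_eq]. *)
Definition rsum : Type := list rterm.

Definition rsum_eq : rsum -> rsum -> Prop := PermutationA req.

Definition supp (E : rsum) (t : rterm) : Prop := Exists (req t) E.

Fixpoint rlift (c : nat) (t : rterm) : rterm :=
  match t with
  | RVar x => RVar (shift_var c x)
  | RLam s => RLam (rlift (S c) s)
  | RApp s ts => RApp (rlift c s) (map (rlift c) ts)
  | RInl s => RInl (rlift c s)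
  | RInr s => RInr (rlift c s)
  end.

(** All [2 ^ length l] ways to distribute the occurrences in [l] between two
    lists, i.e. the pairs of complementary sets of positions of [l]. *)
Fixpoint splits {A : Type} (l : list A) : list (list A * list A) :=
  match l with
  | [] => [([], [])]
  | u :: l =>
      flat_map (fun p => [(u :: fst p, snd p); (fst p, u :: snd p)]) (splits l)
  end.

(** Symmetric multilinear substitution for the variable [k], which is removed
    from the context as in [subst]. On a bag, the sum over the tuples of sets
    of positions is computed by splitting off one component at a time. *)
Fixpoint rsubst (k : nat) (s : rterm) (us : list rterm) : rsum :=
  match s with
  | RVar x =>
      match Nat.compare x k, us with
      | Lt, [] => [RVar x]
      | Eq, [u] => [u]
      | Gt, [] => [RVar (pred x)]
      | _, _ => []
      end
  | RLam s => map RLam (rsubst (S k) s (map (rlift 0) us))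
  | RApp s ts =>
      let rsubst_bag :=
        fix rsubst_bag (ts us : list rterm) : list (list rterm) :=
          match ts with
          | [] => match us with [] => [[]] | _ => [] end
          | t :: ts =>
              flat_map (fun p =>
                flat_map (fun t' => map (cons t') (rsubst_bag ts (snd p)))
                  (rsubst k t (fst p)))
                (splits us)
          end in
      flat_map (fun p =>
        flat_map (fun s' => map (RApp s') (rsubst_bag ts (snd p)))
          (rsubst k s (fst p)))
        (splits us)
  | RInl s => map RInl (rsubst k s us)
  | RInr s => map RInr (rsubst k s us)
  end.

Inductive rstep : rterm -> rsum -> Prop :=
| rstep_beta s ts : rstep (RApp (RLam s) ts) (rsubst 0 s ts)
| rstep_app_inl s ts : rstep (RApp (RInl s) ts) [RInl (RApp s ts)]
| rstep_app_inr s ts : rstep (RApp (RInr s) ts) [RInr (RApp s ts)]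
| rstep_lam_inl s : rstep (RLam (RInl s)) [RInl (RLam s)]
| rstep_lam_inr s : rstep (RLam (RInr s)) [RInr (RLam s)]
| rstep_lam s E : rstep s E -> rstep (RLam s) (map RLam E)
| rstep_fun s E ts :
    rstep s E -> rstep (RApp s ts) (map (fun s' => RApp s' ts) E)
| rstep_arg s ts1 t ts2 E :
    rstep t E ->
    rstep (RApp s (ts1 ++ t :: ts2))
          (map (fun t' => RApp s (ts1 ++ t' :: ts2)) E)
| rstep_inl s E : rstep s E -> rstep (RInl s) (map RInl E)
| rstep_inr s E : rstep s E -> rstep (RInr s) (map RInr E).

(** [rstep] acts on representatives; closing under [rsum_eq] on both sides
    gives the reduction of sums of classes. *)
Inductive sum_step : rsum -> rsum -> Prop :=
| sum_step_intro G e E' F G' :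
    rsum_eq G (e :: F) -> rstep e E' -> rsum_eq G' (E' ++ F) ->
    sum_step G G'.

Definition sum_normal (E : rsum) : Prop := forall E', ~ sum_step E E'.

(** [is_NF E F]: [F] is the normal form of [E]. By confluence and strong
    normalization, there is exactly one such [F] modulo [rsum_eq]. *)
Definition is_NF (E F : rsum) : Prop :=
  clos_refl_trans rsum sum_step E F /\ sum_normal F.

Definition NF_set (X : rterm -> Prop) (t : rterm) : Prop :=
  exists e F, X e /\ is_NF [e] F /\ supp F t.

Inductive taylor : approx -> rterm -> Prop :=
| taylor_var x : taylor (AVar x) (RVar x)
| taylor_lam N t : taylor N t -> taylor (ALam N) (RLam t)
| taylor_app P Q s ts :
    taylor P s -> Forall (taylor Q) ts -> taylor (AApp P Q) (RApp s ts)
| taylor_inl P Q s : taylor P s -> taylor (APlus P Q) (RInl s)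
| taylor_inr P Q t : taylor Q t -> taylor (APlus P Q) (RInr t).

Definition taylor_BT (M : term) (t : rterm) : Prop :=
  exists B, BT M B /\ taylor B t.

Lemma head_red_plus M N :
  head_red (Plus M N) = Plus (head_red M) (head_red N).
Proof. reflexivity. Qed.

Lemma head_red_lams n M :
  (forall P Q, M <> Plus P Q) -> head_red (lams n M) = lams n (head_red M).
Proof.
  intros HM. induction n as [|n IH]; [reflexivity|].
  change (lams (S n) M) with (Lam (lams n M)).
  change (lams (S n) (head_red M)) with (Lam (lams n (head_red M))).
  rewrite <- IH. destruct n as [|n]; [|reflexivity].
  cbn. destruct M; try reflexivity. now destruct (HM M1 M2).
Qed.

Lemma head_red_lam_plus n M N :
  head_red (lams n (Lam (Plus M N))) = lams n (Plus (Lam M) (Lam N)).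
Proof. now rewrite head_red_lams. Qed.

Lemma apps_app_not_plus M N Qs P Q : apps (App M N) Qs <> Plus P Q.
Proof. revert M N. induction Qs as [|R Qs IH]; [easy|]. intros; apply IH. Qed.

Lemma head_red_apps M N Qs :
  neutral (App M N) = false ->
  head_red (apps (App M N) Qs) = apps (head_red (App M N)) Qs.
Proof.
  revert M N. induction Qs as [|R Qs IH]; intros M N HM; [reflexivity|].
  change (head_red (apps (App (App M N) R) Qs)
          = apps (App (head_red (App M N)) R) Qs).
  rewrite IH by exact HM. f_equal.
  change (App (head_red (App M N))
              (if neutral (App M N) then head_red R else R)
          = App (head_red (App M N)) R).
  now rewrite HM.
Qed.

Lemma head_red_app_plus n M N P Qs :
  head_red (lams n (apps (App (Plus M N) P) Qs))
  = lams n (apps (Plus (App M P) (App N P)) Qs).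
Proof.
  rewrite head_red_lams by apply apps_app_not_plus.
  now rewrite head_red_apps.
Qed.

Lemma head_red_beta n M N Qs :
  head_red (lams n (apps (App (Lam M) N) Qs))
  = lams n (apps (subst 0 N M) Qs).
Proof.
  rewrite head_red_lams by apply apps_app_not_plus.
  now rewrite head_red_apps.
Qed.

Lemma neutral_apps M Qs : neutral M = true -> neutral (apps M Qs) = true.
Proof.
  revert M. induction Qs as [|R Qs IH]; [easy|].
  intros M HM. now apply (IH (App M R)).
Qed.

Lemma head_red_apps_neutral M Qs :
  neutral M = true ->
  head_red (apps M Qs) = apps (head_red M) (map head_red Qs).
Proof.
  revert M. induction Qs as [|R Qs IH]; intros M HM; [reflexivity|].
  change (head_red (apps (App M R) Qs)
          = apps (App (head_red M) (head_red R)) (map head_red Qs)).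
  rewrite IH by exact HM. f_equal.
  destruct M; try discriminate HM; [reflexivity|].
  change (App (head_red (App M1 M2))
              (if neutral (App M1 M2) then head_red R else R)
          = App (head_red (App M1 M2)) (head_red R)).
  now rewrite HM.
Qed.

Lemma head_red_hnf n y Qs :
  head_red (lams n (apps (Var y) Qs))
  = lams n (apps (Var y) (map head_red Qs)).
Proof.
  rewrite head_red_lams.
  - now rewrite head_red_apps_neutral.
  - destruct Qs as [|R Qs]; [easy|]. apply apps_app_not_plus.
Qed.

Lemma eBT_plus M N : eBT (Plus M N) = APlus (eBT M) (eBT N).
Proof. reflexivity. Qed.

Lemma hnf_lams n M : hnf (lams n M) = hnf M.
Proof. induction n; auto. Qed.

Lemma neutral_hnf M : neutral M = true -> hnf M = true.
Proof. destruct M; easy. Qed.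

Lemma eBT_hnf n x Qs :
  eBT (lams n (apps (Var x) Qs)) = alams n (aapps (AVar x) (map eBT Qs)).
Proof.
  assert (Happs : forall Qs M, neutral M = true ->
            eBT (apps M Qs) = aapps (eBT M) (map eBT Qs)).
  { clear. induction Qs as [|R Qs IH]; intros M HM; [reflexivity|].
    cbn. change (eBT (apps (App M R) Qs)
                 = aapps (AApp (eBT M) (eBT R)) (map eBT Qs)).
    rewrite IH by exact HM. cbn. now rewrite HM. }
  induction n as [|n IH].
  - exact (Happs Qs (Var x) eq_refl).
  - change (eBT (Lam (lams n (apps (Var x) Qs)))
            = ALam (alams n (aapps (AVar x) (map eBT Qs)))).
    rewrite <- IH. cbn [eBT].
    rewrite hnf_lams, neutral_hnf; [reflexivity|]. now apply neutral_apps.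
Qed.

Lemma neutral_inv M : neutral M = true -> exists x Qs, M = apps (Var x) Qs.
Proof.
  induction M as [x| |M IHM N _|]; try discriminate.
  - exists x, []. reflexivity.
  - intros HM. destruct (IHM HM) as (x & Qs & ->).
    exists x, (Qs ++ [N]). unfold apps. now rewrite fold_left_app.
Qed.

Lemma hnf_inv M : hnf M = true -> exists n x Qs, M = lams n (apps (Var x) Qs).
Proof.
  induction M as [x|M IHM|M _ N _|]; try discriminate; intros HM.
  - exists 0, x, []. reflexivity.
  - destruct (IHM HM) as (n & x & Qs & ->). exists (S n), x, Qs. reflexivity.
  - destruct (neutral_inv _ HM) as (x & Qs & ->). exists 0, x, Qs. reflexivity.
Qed.

Lemma eBT_otherwise M :
  (forall P Q, M <> Plus P Q) ->
  (forall n x Qs, M <> lams n (apps (Var x) Qs)) ->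
  eBT M = ABot.
Proof.
  intros Hplus Hhnf.
  assert (HM : hnf M = false).
  { destruct (hnf M) eqn:HM; [|reflexivity].
    destruct (hnf_inv _ HM) as (n & x & Qs & E). now destruct (Hhnf n x Qs). }
  destruct M as [x|M|M N|M N]; cbn in HM |- *.
  - discriminate.
  - now rewrite HM.
  - now rewrite HM.
  - now destruct (Hplus M N).
Qed.

Fixpoint req_refl (s : rterm) : req s s :=
  match s with
  | RVar x => req_var x
  | RLam s => req_lam _ _ (req_refl s)
  | RApp s ts =>
      req_app _ _ _ _ (req_refl s)
        ((fix bag_refl (ts : list rterm) : PermutationA req ts ts :=
            match ts with
            | [] => permA_nil _
            | t :: ts => permA_skip (req_refl t) (bag_refl ts)
            end) ts)
  | RInl s => req_inl _ _ (req_refl s)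
  | RInr s => req_inr _ _ (req_refl s)
  end.

Fixpoint req_sym (s t : rterm) (H : req s t) : req t s :=
  match H with
  | req_var x => req_var x
  | req_lam _ _ H => req_lam _ _ (req_sym _ _ H)
  | req_app _ _ _ _ H Hts =>
      req_app _ _ _ _ (req_sym _ _ H)
        ((fix bag_sym ts ts' (H : PermutationA req ts ts')
            : PermutationA req ts' ts :=
            match H with
            | permA_nil _ => permA_nil _
            | permA_skip H Hl => permA_skip (req_sym _ _ H) (bag_sym _ _ Hl)
            | permA_swap _ x y l => permA_swap _ y x l
            | permA_trans H1 H2 =>
                permA_trans (bag_sym _ _ H2) (bag_sym _ _ H1)
            end) _ _ Hts)
  | req_inl _ _ H => req_inl _ _ (req_sym _ _ H)
  | req_inr _ _ H => req_inr _ _ (req_sym _ _ H)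
  end.

Lemma req_trans s t u : req s t -> req t u -> req s u.
Proof.
  intros Hst; revert t Hst u.
  induction s; intros t Hst u Htu; inversion Hst; subst; inversion Htu; subst;
    constructor; eauto using permA_trans.
Qed.

#[export] Instance req_equiv : Equivalence req.
Proof. split; [exact req_refl|exact req_sym|exact req_trans]. Qed.

Lemma taylor_req N s t : req s t -> taylor N s -> taylor N t.
Proof.
  intros H HN; revert t H. revert N s HN.
  assert (Hbag : forall Q,
    (forall s t, req s t -> taylor Q s -> taylor Q t) ->
    forall ts ts', PermutationA req ts ts' ->
    Forall (taylor Q) ts -> Forall (taylor Q) ts').
  { intros Q HQ ts ts' H.
    induction H as [|t t' l l' Ht Hl IH|t t' l|l1 l2 l3 _ IH1 _ IH2].
    - trivial.
    - intros HF. inversion HF; subst. constructor; eauto.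
    - intros HF. inversion HF as [|? ? H1 HF']; subst.
      inversion HF' as [|? ? H2 HF'']; subst. repeat constructor; trivial.
    - auto. }
  induction N as [|x|N IHN|P IHP Q IHQ|P IHP Q IHQ]; intros s HN t H;
    inversion HN; subst; inversion H; subst; constructor; eauto.
Qed.

(* Main.v *)
From Stdlib Require Import Arith Lia List Relations.
From Stdlib Require Import Permutation SetoidPermutation SetoidList.
Require Import Defs.
Import ListNotations.

(** Coefficients are natural numbers, so nothing cancels: together with the
    termination of resource reduction, this makes the membership of [t] in
    [NF_set (taylor M)] equivalent to the existence of a path of nondeterministic
    steps, each picking one summand of the contractum, from an element of
    [taylor M] to the normal resource term [t].

    If [t] is in [taylor (head_red M)], such a path leads to [t] from some
    element of [taylor M]; as [taylor (eBT N)] is made of normal elements of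
    [taylor N], iterating this gives the left-to-right inclusion.

    For the converse, the path is rearranged into a head evaluation, which
    [head_red] can follow on the side of terms. No confluence or standardization
    theorem is needed: evaluations to a normal form, presented as runs of an
    abstract machine on a term and a stack of bags, are stable under
    expansion by an arbitrary step in the term or in the stack. The substance of
    this stability is that a step in [s] or in [us] survives as a single step in
    each summand of the multilinear substitution of [us] in [s]. *)

(** * Permutations, nested induction and lifting *)

Ltac inv H := inversion H; subst; clear H.

Ltac perm_norm :=
  repeat match goal with
  | |- context [?x :: ?l] =>
      lazymatch l with [] => fail | _ => change (x :: l) with ([x] ++ l) end
  end;
  rewrite ?app_nil_r, <- ?app_assoc.

(** The front block on the right is sent to the back until it matches the front block on the left,
    and is then cancelled; [n] bounds the number of rotations. *)
Ltac perm_rot n :=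
  lazymatch n with
  | O => fail
  | S ?m =>
    lazymatch goal with
    | |- Permutation ?a ?a => reflexivity
    | |- Permutation (?a ++ _) (?a ++ _) => apply Permutation_app_head
    | |- Permutation (_ ++ _) (?b ++ ?R) =>
        transitivity (R ++ b); [rewrite <- ?app_assoc; perm_rot m
                               |apply Permutation_app_comm]
    end
  end.
Ltac perm := perm_norm; repeat perm_rot 8.

(** Two selections of an element from the same bag either agree or leave a common remainder [k].
    This compares the element selected by [ev_bag] with the one reduced by [bag_red]. *)
Lemma perm_cons_cons {A} (t a : A) l m :
  Permutation (t :: l) (a :: m) ->
  t = a /\ Permutation l m \/
  exists k, Permutation l (a :: k) /\ Permutation m (t :: k).
Proof.
  intros H.
  assert (Hin : In t (a :: m)) by (rewrite <- H; now left).
  destruct Hin as [->|Hin].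
  - left. split; [reflexivity|]. exact (Permutation_cons_inv H).
  - right. apply in_split in Hin as (m1 & m2 & ->).
    exists (m1 ++ m2). split; [|symmetry; apply Permutation_middle].
    apply (Permutation_cons_inv (a := t)). rewrite H. perm.
Qed.

Lemma perm_cons_app {A} (u : A) l l1 l2 :
  Permutation (u :: l) (l1 ++ l2) ->
  (exists k, Permutation l1 (u :: k) /\ Permutation l (k ++ l2)) \/
  (exists k, Permutation l2 (u :: k) /\ Permutation l (l1 ++ k)).
Proof.
  intros H.
  assert (Hin : In u (l1 ++ l2)) by (rewrite <- H; now left).
  apply in_app_or in Hin as [Hin|Hin];
    apply in_split in Hin as (m1 & m2 & ->); [left|right];
    exists (m1 ++ m2); (split; [symmetry; apply Permutation_middle|]);
    apply (Permutation_cons_inv (a := u)); rewrite H; perm.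
Qed.

Lemma map_perm_app_inv {A B} (f : A -> B) l l1 l2 :
  Permutation (map f l) (l1 ++ l2) ->
  exists m1 m2, l1 = map f m1 /\ l2 = map f m2 /\ Permutation l (m1 ++ m2).
Proof.
  intros H. symmetry in H. apply Permutation_map_inv in H as (m & E & Hm).
  symmetry in E. apply map_eq_app in E as (m1 & m2 & -> & <- & <-).
  eauto.
Qed.

(** Since bags nest [rterm] under [list], an induction on resource terms needs a hypothesis for each
    element of a bag. *)
Section rterm_nested_ind.
  Variable P : rterm -> Prop.
  Hypothesis HVar : forall x, P (RVar x).
  Hypothesis HLam : forall s, P s -> P (RLam s).
  Hypothesis HApp : forall s ts, P s -> Forall P ts -> P (RApp s ts).
  Hypothesis HInl : forall s, P s -> P (RInl s).
  Hypothesis HInr : forall s, P s -> P (RInr s).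

  Fixpoint rterm_nested_ind (t : rterm) : P t :=
    match t with
    | RVar x => HVar x
    | RLam s => HLam s (rterm_nested_ind s)
    | RApp s ts =>
        HApp s ts (rterm_nested_ind s)
          ((fix bag_ind ts : Forall P ts :=
              match ts with
              | [] => Forall_nil P
              | t :: ts => Forall_cons t (rterm_nested_ind t) (bag_ind ts)
              end) ts)
    | RInl s => HInl s (rterm_nested_ind s)
    | RInr s => HInr s (rterm_nested_ind s)
    end.
End rterm_nested_ind.

Ltac var_cases :=
  unfold shift_var in *;
  repeat match goal with
  | |- context [?x <? ?c] => destruct (Nat.ltb_spec x c)
  | H : context [?x <? ?c] |- _ => destruct (Nat.ltb_spec x c)
  end.

Lemma rlift_rlift c d t :
  c <= d -> rlift (S d) (rlift c t) = rlift c (rlift d t).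
Proof.
  revert c d. induction t using rterm_nested_ind; intros c d Hcd; simpl;
    rewrite ?IHt by lia; try reflexivity.
  - f_equal. var_cases; lia.
  - rewrite !map_map. f_equal. apply map_ext_Forall.
    eapply Forall_impl; [|eassumption]. simpl. auto.
Qed.

Lemma map_rlift_rlift c d ts :
  c <= d ->
  map (rlift (S d)) (map (rlift c) ts) = map (rlift c) (map (rlift d) ts).
Proof.
  intros. rewrite !map_map. apply map_ext. intros. now apply rlift_rlift.
Qed.

(** * Multilinear substitution *)

(** [lsub k s us r]: [r] occurs in [rsubst k s us], up to the order of [us]. *)
Inductive lsub : nat -> rterm -> list rterm -> rterm -> Prop :=
| lsub_lt k x : x < k -> lsub k (RVar x) [] (RVar x)
| lsub_eq k u : lsub k (RVar k) [u] u
| lsub_gt k x : k < x -> lsub k (RVar x) [] (RVar (pred x))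
| lsub_lam k s us r :
    lsub (S k) s (map (rlift 0) us) r -> lsub k (RLam s) us (RLam r)
| lsub_app k s ts us us1 us2 r rs :
    Permutation us (us1 ++ us2) -> lsub k s us1 r -> lsubs k ts us2 rs ->
    lsub k (RApp s ts) us (RApp r rs)
| lsub_inl k s us r : lsub k s us r -> lsub k (RInl s) us (RInl r)
| lsub_inr k s us r : lsub k s us r -> lsub k (RInr s) us (RInr r)
with lsubs : nat -> list rterm -> list rterm -> list rterm -> Prop :=
| lsubs_nil k : lsubs k [] [] []
| lsubs_cons k t ts us us1 us2 r rs :
    Permutation us (us1 ++ us2) -> lsub k t us1 r -> lsubs k ts us2 rs ->
    lsubs k (t :: ts) us (r :: rs).

Scheme lsub_mind := Minimality for lsub Sort Prop
  with lsubs_mind := Minimality for lsubs Sort Prop.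
Combined Scheme lsub_mutind from lsub_mind, lsubs_mind.

#[local] Hint Constructors lsub lsubs : lsub.

Lemma lsub_perm k s us us' r :
  Permutation us us' -> lsub k s us r -> lsub k s us' r.
Proof.
  intros H Hs. revert us' H. induction Hs; intros us' H'.
  1,3: apply Permutation_nil in H' as ->; auto with lsub.
  - apply Permutation_length_1_inv in H' as ->. constructor.
  - constructor. apply IHHs. now apply Permutation_map.
  - econstructor; [rewrite <- H'|..]; eassumption.
  - constructor; auto.
  - constructor; auto.
Qed.

(** Each element of the bag keeps its share of [us], so its image moves along with it. *)
Lemma lsubs_bag_perm k ts ts' us rs :
  Permutation ts ts' -> lsubs k ts us rs ->
  exists rs', lsubs k ts' us rs' /\ Permutation rs rs'.
Proof.
  intros H. revert us rs.
  induction H as [|t ts ts' H IH|t t' ts|ts ts' ts'' H1 IH1 H2 IH2];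
    intros us rs Hs.
  - eauto.
  - inversion Hs as [|? ? ? ? us1 us2 r rs0 Hus Ht Hts]; subst.
    destruct (IH _ _ Hts) as (rs' & Hrs & Hp).
    exists (r :: rs'). split; [econstructor; eassumption|now constructor].
  - inversion Hs as [|? ? ? ? us1 us2 r rs0 Hus Ht Hts]; subst.
    inversion Hts as [|? ? ? ? us3 us4 r' rs1 Hus' Ht' Hts']; subst.
    exists (r' :: r :: rs1). split; [|constructor].
    econstructor; [|eassumption|econstructor; [reflexivity|eassumption..]].
    rewrite Hus, Hus'. perm.
  - destruct (IH1 _ _ Hs) as (rs1 & Hs1 & P1).
    destruct (IH2 _ _ Hs1) as (rs2 & Hs2 & P2).
    exists rs2. split; [assumption|]. now transitivity rs1.
Qed.

Lemma lsubs_app k ts1 ts2 us1 us2 rs1 rs2 :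
  lsubs k ts1 us1 rs1 -> lsubs k ts2 us2 rs2 ->
  lsubs k (ts1 ++ ts2) (us1 ++ us2) (rs1 ++ rs2).
Proof.
  intros H1 H2. induction H1 as [|k t ts us a b r rs Hp Ht Hts IH]; [exact H2|].
  simpl. econstructor; [|eassumption|exact (IH H2)]. rewrite Hp. perm.
Qed.

(** The variable [j] does not occur in [rlift j r]: no resource is consumed, and removing [j] from
    the context undoes the lift. *)
Lemma lsub_rlift_nil j r : lsub j (rlift j r) [] r.
Proof.
  revert j. induction r using rterm_nested_ind; intros j; simpl;
    try (constructor; simpl; auto; fail).
  - var_cases; [now constructor|]. apply (lsub_gt j (S x)). lia.
  - apply (lsub_app j _ _ _ [] []); [reflexivity|apply IHr|].
    induction H; simpl; [constructor|].
    apply (lsubs_cons j _ _ _ [] []); [reflexivity|auto|assumption].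
Qed.

(** The index shifts from [c] to [S c] inside the body because the variable [k], below it, is still
    in the context there. *)
Lemma lsub_lsubs_rlift :
  (forall k s us r, lsub k s us r -> forall c, k <= c ->
     lsub k (rlift (S c) s) (map (rlift c) us) (rlift c r)) /\
  (forall k ts us rs, lsubs k ts us rs -> forall c, k <= c ->
     lsubs k (map (rlift (S c)) ts) (map (rlift c) us) (map (rlift c) rs)).
Proof.
  apply lsub_mutind; simpl.
  - intros k x Hx c Hc. var_cases; try lia. now constructor.
  - intros k u c Hc. var_cases; try lia. constructor.
  - intros k x Hx c Hc.
    replace (shift_var c (pred x)) with (pred (shift_var (S c) x))
      by (var_cases; lia).
    constructor. var_cases; lia.
  - intros k s us r _ IH c Hc. constructor.
    rewrite <- map_rlift_rlift by lia. apply IH. lia.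
  - intros k s ts us us1 us2 r rs Hp _ IH1 _ IH2 c Hc.
    econstructor; [|apply IH1; lia|apply IH2; lia].
    rewrite <- map_app. now apply Permutation_map.
  - intros. constructor. auto.
  - intros. constructor. auto.
  - constructor.
  - intros k t ts us us1 us2 r rs Hp _ IH1 _ IH2 c Hc.
    econstructor; [|apply IH1; lia|apply IH2; lia].
    rewrite <- map_app. now apply Permutation_map.
Qed.

(** Bag version of [lsub_rlift_inv], whose conclusion for the elements is taken as a hypothesis: it
    can thus be used both inside the induction that proves [lsub_rlift_inv] and after it. *)
Lemma lsubs_map_inv k (f g : rterm -> rterm) ts us rs :
  Forall (fun t => forall us r, lsub (S k) (f t) (map g us) r ->
            exists r', r = g r' /\ lsub k t us r') ts ->
  lsubs (S k) (map f ts) (map g us) rs ->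
  exists rs', rs = map g rs' /\ lsubs k ts us rs'.
Proof.
  intros Hts. revert us rs. induction Hts as [|t ts Ht Hts IH]; simpl;
    intros us rs H; inversion H as [? Ek Et Eu|? ? ? ? us1 us2 r rs0 Hp H1 H2]; subst.
  - symmetry in Eu. apply map_eq_nil in Eu as ->. exists []. now split; [|constructor].
  - apply map_perm_app_inv in Hp as (vs1 & vs2 & -> & -> & Hp).
    destruct (Ht _ _ H1) as (r' & -> & H1').
    destruct (IH _ _ H2) as (rs' & -> & H2').
    exists (r' :: rs'). split; [reflexivity|]. econstructor; eassumption.
Qed.

(** Neither the term nor the resources mention the variable [c], so the result does not either, and
    the lift can be pulled out. *)
Lemma lsub_rlift_inv k c s us r :
  c <= k -> lsub (S k) (rlift c s) (map (rlift c) us) r ->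
  exists r', r = rlift c r' /\ lsub k s us r'.
Proof.
  revert k c us r. induction s using rterm_nested_ind;
    simpl; intros k c us r Hc H'.
  - inversion H' as [? y Hy Ek Ey Eu|? u Ek Ey Eu|? y Hy Ek Ey Eu| | | |]; subst.
    + symmetry in Eu. apply map_eq_nil in Eu as ->.
      exists (RVar x). split; [reflexivity|]. constructor. var_cases; lia.
    + destruct us as [|u0 [|]]; try discriminate. injection Eu as ->.
      exists u0. split; [reflexivity|].
      replace x with k by (var_cases; lia). constructor.
    + symmetry in Eu. apply map_eq_nil in Eu as ->.
      exists (RVar (pred x)). split; [|constructor; var_cases; lia].
      simpl. f_equal. var_cases; lia.
  - inversion H' as [| | |? ? ? r0 H0| | |]; subst.
    rewrite <- map_rlift_rlift in H0 by lia.
    destruct (IHs (S k) (S c) _ _ (le_n_S _ _ Hc) H0) as (r' & -> & Hr).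
    exists (RLam r'). split; [reflexivity|now constructor].
  - inversion H' as [| | | |? ? ? ? us1 us2 r0 rs Hp H1 H2| |]; subst.
    apply map_perm_app_inv in Hp as (vs1 & vs2 & -> & -> & Hp).
    destruct (IHs _ _ _ _ Hc H1) as (r' & -> & H1').
    apply lsubs_map_inv in H2 as (rs' & -> & H2').
    + exists (RApp r' rs'). split; [reflexivity|]. econstructor; eassumption.
    + eapply Forall_impl; [|eassumption]. simpl. eauto.
  - inversion H' as [| | | | |? ? ? r0 H0|]; subst.
    destruct (IHs _ _ _ _ Hc H0) as (r' & -> & Hr).
    exists (RInl r'). split; [reflexivity|now constructor].
  - inversion H' as [| | | | | |? ? ? r0 H0]; subst.
    destruct (IHs _ _ _ _ Hc H0) as (r' & -> & Hr).
    exists (RInr r'). split; [reflexivity|now constructor].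
Qed.

(** Commutation of two multilinear substitutions, one summand at a time: when [us] is substituted in
    a summand of the substitution of [ts] in [a], each resource lands either at an occurrence coming
    from [a] or inside an element of [ts], which splits [us] into [us1] and [us2]. The inner
    variable is [j]; the outer one is [j + k], or [S (j + k)] where [j] is still in the context. *)
Lemma lsub_lsubs_comm :
  (forall j a ts s, lsub j a ts s -> forall k us r, lsub (j + k) s us r ->
     exists us1 us2 a1 ts1,
       Permutation us (us1 ++ us2) /\
       lsub (S (j + k)) a (map (rlift j) us1) a1 /\
       lsubs (j + k) ts us2 ts1 /\ lsub j a1 ts1 r) /\
  (forall j bs ts ss, lsubs j bs ts ss -> forall k us rs, lsubs (j + k) ss us rs ->
     exists us1 us2 bs1 ts1,
       Permutation us (us1 ++ us2) /\
       lsubs (S (j + k)) bs (map (rlift j) us1) bs1 /\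
       lsubs (j + k) ts us2 ts1 /\ lsubs j bs1 ts1 rs).
Proof.
  apply lsub_mutind.
  - intros j x Hx k us r H. inversion H; subst; try lia.
    exists [], [], (RVar x), []. repeat split; constructor; lia.
  (* The occurrence of [j] is filled by [u], so all of [us] goes into [u]. *)
  - intros j u k us r H. exists [], us, (RVar j), [r]. repeat split.
    + reflexivity.
    + constructor; lia.
    + apply (lsubs_cons _ _ _ _ us []); [now rewrite app_nil_r|exact H|].
      constructor.
    + constructor.
  - intros j x Hx k us r H. inversion H; subst.
    + exists [], [], (RVar x), []. repeat split; constructor; lia.
    (* Here [x] is the outer variable: its resource [r] is lifted past [j], and [lsub_rlift_nil]
       undoes the lift. *)
    + exists [r], [], (rlift j r), []. repeat split.
      * reflexivity.
      * replace x with (S (j + k)) by lia. constructor.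
      * constructor.
      * apply lsub_rlift_nil.
    + exists [], [], (RVar (pred x)), []. repeat split; constructor; lia.
  - intros j s ts r _ IH k us r' H. inversion H as [| | |? ? ? r0 H'| | |]; subst.
    destruct (IH _ _ _ H') as (us1 & us2 & a1 & ts1 & Hp & H1 & H2 & H3).
    apply map_perm_app_inv in Hp as (vs1 & vs2 & -> & -> & Hp).
    rewrite map_rlift_rlift in H1 by lia.
    (* Both bags were lifted to go under the abstraction; the resulting bag is therefore a lifted
       one and can be brought back outside. *)
    apply lsubs_map_inv in H2 as (ts1' & -> & H2').
    + exists vs1, vs2, (RLam a1), ts1'. repeat split; try assumption;
        now constructor.
    + apply Forall_forall. intros t _ vs v. apply lsub_rlift_inv. lia.
  - intros j s bs ts ts1 ts2 s' ss Hts _ IH1 _ IH2 k us r H.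
    inversion H as [| | | |? ? ? ? us1 us2 r0 rs Hp H1 H2| |]; subst.
    destruct (IH1 _ _ _ H1) as (us11 & us12 & a & ts1' & P1 & A1 & B1 & C1).
    destruct (IH2 _ _ _ H2) as (us21 & us22 & bs' & ts2' & P2 & A2 & B2 & C2).
    destruct (lsubs_bag_perm _ _ _ _ _ (Permutation_sym Hts)
                (lsubs_app _ _ _ _ _ _ _ B1 B2)) as (ts' & B & Hts').
    exists (us11 ++ us21), (us12 ++ us22), (RApp a bs'), ts'. repeat split.
    + rewrite Hp, P1, P2. perm.
    + rewrite map_app. econstructor; [reflexivity|eassumption..].
    + exact B.
    + econstructor; [symmetry; exact Hts'|eassumption..].
  - intros j s ts r _ IH k us r' H. inversion H as [| | | | |? ? ? r0 H'|]; subst.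
    destruct (IH _ _ _ H') as (us1 & us2 & a1 & ts1 & Hp & H1 & H2 & H3).
    exists us1, us2, (RInl a1), ts1. repeat split; auto with lsub.
  - intros j s ts r _ IH k us r' H. inversion H as [| | | | | |? ? ? r0 H']; subst.
    destruct (IH _ _ _ H') as (us1 & us2 & a1 & ts1 & Hp & H1 & H2 & H3).
    exists us1, us2, (RInr a1), ts1. repeat split; auto with lsub.
  - intros j k us rs H. inversion H; subst.
    exists [], [], [], []. repeat split; constructor.
  - intros j s bs ts ts1 ts2 s' ss Hts _ IH1 _ IH2 k us r H.
    inversion H as [|? ? ? ? us1 us2 r0 rs Hp H1 H2]; subst.
    destruct (IH1 _ _ _ H1) as (us11 & us12 & a & ts1' & P1 & A1 & B1 & C1).
    destruct (IH2 _ _ _ H2) as (us21 & us22 & bs' & ts2' & P2 & A2 & B2 & C2).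
    destruct (lsubs_bag_perm _ _ _ _ _ (Permutation_sym Hts)
                (lsubs_app _ _ _ _ _ _ _ B1 B2)) as (ts' & B & Hts').
    exists (us11 ++ us21), (us12 ++ us22), (a :: bs'), ts'. repeat split.
    + rewrite Hp, P1, P2. perm.
    + rewrite map_app. econstructor; [reflexivity|eassumption..].
    + exact B.
    + econstructor; [symmetry; exact Hts'|eassumption..].
Qed.

(** * Nondeterministic reduction *)

(** One nondeterministic step, picking one summand of the contractum. Reflexivity
    makes [red_arg] also account for the reordering of bags. *)
Inductive red : rterm -> rterm -> Prop :=
| red_refl s : red s s
| red_beta s ts r : lsub 0 s ts r -> red (RApp (RLam s) ts) r
| red_app_inl s ts : red (RApp (RInl s) ts) (RInl (RApp s ts))
| red_app_inr s ts : red (RApp (RInr s) ts) (RInr (RApp s ts))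
| red_lam_inl s : red (RLam (RInl s)) (RInl (RLam s))
| red_lam_inr s : red (RLam (RInr s)) (RInr (RLam s))
| red_lam s s' : red s s' -> red (RLam s) (RLam s')
| red_fun s s' ts : red s s' -> red (RApp s ts) (RApp s' ts)
| red_arg s t t' l ts ts' :
    red t t' -> Permutation ts (t :: l) -> Permutation ts' (t' :: l) ->
    red (RApp s ts) (RApp s ts')
| red_inl s s' : red s s' -> red (RInl s) (RInl s')
| red_inr s s' : red s s' -> red (RInr s) (RInr s').

#[local] Hint Constructors red : red.

(** By [red_refl], this includes the reordering of a nonempty bag; it never holds of the empty
    bag. *)
Definition bag_red (ts ts' : list rterm) : Prop :=
  exists t t' l,
    red t t' /\ Permutation ts (t :: l) /\ Permutation ts' (t' :: l).

Lemma red_bag s ts ts' : bag_red ts ts' -> red (RApp s ts) (RApp s ts').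
Proof. intros (t & t' & l & H & H1 & H2). eapply red_arg; eassumption. Qed.

Lemma bag_red_cons t ts ts' : bag_red ts ts' -> bag_red (t :: ts) (t :: ts').
Proof.
  intros (u & u' & l & H & H1 & H2). exists u, u', (t :: l).
  repeat split; [assumption|rewrite H1; perm|rewrite H2; perm].
Qed.

Lemma bag_red_head t t' ts : red t t' -> bag_red (t :: ts) (t' :: ts).
Proof. intros H. exists t, t', ts. auto. Qed.

Lemma red_rlift c s s' : red s s' -> red (rlift c s) (rlift c s').
Proof.
  intros H. revert c. induction H; intros c; simpl; try (constructor; auto; fail).
  - apply red_beta. apply lsub_lsubs_rlift; [assumption|lia].
  - eapply red_arg; [apply IHred|..].
    + change (rlift c t :: ?l) with (map (rlift c) (t :: l)).
      rewrite <- (map_cons (rlift c)). apply Permutation_map. eassumption.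
    + rewrite <- (map_cons (rlift c)). now apply Permutation_map.
Qed.

(** Multilinear substitution neither erases nor duplicates a redex of [s'], so the step can be
    postponed after it; for a beta redex this is [lsub_lsubs_comm]. *)
Lemma red_lsub s' s k us r :
  red s' s -> lsub k s us r -> exists r', lsub k s' us r' /\ red r' r.
Proof.
  intros H. revert k us r. induction H as
    [s|s ts r H|s ts|s ts|s|s|s s' H IH|s s' ts H IH|s t t' l ts ts' H IH P1 P2
    |s s' H IH|s s' H IH]; intros k us r0 Hr.
  1: eauto with red.
  (* These are the four exchanges with a choice; next come the congruences other than [red_arg], so
     that only beta and [red_arg] remain. *)
  2-5: inv Hr; match goal with
       | H : lsub _ (RApp _ _) _ _ |- _ => inv H
       | H : lsub _ (RLam _) _ _ |- _ => inv H
       end; eauto with red lsub.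
  2,3,5,6: inv Hr; edestruct IH as (? & ? & ?); [eassumption|];
    eauto with red lsub.
  - destruct (proj1 lsub_lsubs_comm _ _ _ _ H k us r0 Hr)
      as (us1 & us2 & a1 & ts1 & Hp & H1 & H2 & H3).
    exists (RApp (RLam a1) ts1). split; [|now constructor].
    econstructor; [eassumption| |eassumption]. constructor. exact H1.
  - inversion Hr as [| | | |? ? ? ? us1 us2 r1 rs Hp Hs Hts| |]; subst.
    destruct (lsubs_bag_perm _ _ _ _ _ P2 Hts) as (rs1 & Hrs1 & Q1).
    inversion Hrs1 as [|? ? ? ? vs1 vs2 r2 rs2 Hp' Ht Hl]; subst.
    destruct (IH _ _ _ Ht) as (r2' & Ht' & Hr2).
    assert (Hl' : lsubs k (t :: l) us2 (r2' :: rs2)) by eauto with lsub.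
    destruct (lsubs_bag_perm _ _ _ _ _ (Permutation_sym P1) Hl')
      as (rs' & Hrs' & Q2).
    exists (RApp r1 rs'). split; [eauto with lsub|].
    eapply red_arg; [exact Hr2|symmetry; exact Q2|exact Q1].
Qed.

(** A summand uses each resource exactly once, so replacing [u] by [u'] changes the result at a
    single place. *)
Lemma lsub_lsubs_arg_red :
  (forall k s us r, lsub k s us r -> forall u' u l,
     Permutation us (u :: l) -> red u' u ->
     exists r', lsub k s (u' :: l) r' /\ red r' r) /\
  (forall k ts us rs, lsubs k ts us rs -> forall u' u l,
     Permutation us (u :: l) -> red u' u ->
     exists rs', lsubs k ts (u' :: l) rs' /\ bag_red rs' rs).
Proof.
  apply lsub_mutind.
  - intros k x Hx u' u l H. now apply Permutation_nil_cons in H.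
  - intros k v u' u l H Hu. apply Permutation_length_1_inv in H.
    injection H as -> ->. exists u'. split; [constructor|assumption].
  - intros k x Hx u' u l H. now apply Permutation_nil_cons in H.
  - intros k s us r _ IH u' u l H Hu.
    destruct (IH (rlift 0 u') (rlift 0 u) (map (rlift 0) l)) as (r' & H1 & H2).
    + rewrite <- (map_cons (rlift 0)). now apply Permutation_map.
    + now apply red_rlift.
    + exists (RLam r'). split; now constructor.
  - intros k s ts us us1 us2 r rs Hp Hs IHs Hts IHts u' u l H Hu.
    rewrite H in Hp. apply perm_cons_app in Hp as [(m & P1 & P2)|(m & P1 & P2)].
    + destruct (IHs _ _ _ P1 Hu) as (r' & H1 & H2).
      exists (RApp r' rs). split; [|now constructor].
      econstructor; [|eassumption..]. rewrite P2. perm.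
    + destruct (IHts _ _ _ P1 Hu) as (rs' & H1 & H2).
      exists (RApp r rs'). split; [|now apply red_bag].
      econstructor; [|eassumption..]. rewrite P2. perm.
  - intros k s us r _ IH u' u l H Hu.
    destruct (IH _ _ _ H Hu) as (r' & H1 & H2). eauto with red lsub.
  - intros k s us r _ IH u' u l H Hu.
    destruct (IH _ _ _ H Hu) as (r' & H1 & H2). eauto with red lsub.
  - intros k u' u l H. now apply Permutation_nil_cons in H.
  - intros k t ts us us1 us2 r rs Hp Hs IHs Hts IHts u' u l H Hu.
    rewrite H in Hp. apply perm_cons_app in Hp as [(m & P1 & P2)|(m & P1 & P2)].
    + destruct (IHs _ _ _ P1 Hu) as (r' & H1 & H2).
      exists (r' :: rs). split; [|now apply bag_red_head].
      econstructor; [|eassumption..]. rewrite P2. perm.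
    + destruct (IHts _ _ _ P1 Hu) as (rs' & H1 & H2).
      exists (r :: rs'). split; [|now apply bag_red_cons].
      econstructor; [|eassumption..]. rewrite P2. perm.
Qed.

Lemma lsub_bag_red k s us' us r :
  bag_red us' us -> lsub k s us r -> exists r', lsub k s us' r' /\ red r' r.
Proof.
  intros (u' & u & l & Hu & P1 & P2) H.
  destruct (proj1 lsub_lsubs_arg_red _ _ _ _ H _ _ _ P2 Hu) as (r' & H1 & H2).
  exists r'. split; [|assumption]. eapply lsub_perm; [symmetry|]; eassumption.
Qed.

(** * Head evaluation *)

Definition rapps (s : rterm) (tss : list (list rterm)) : rterm :=
  fold_left RApp tss s.

(** The normal form of [RLam t] when [t] is normal. *)
Fixpoint rlam_nf (t : rterm) : rterm :=
  match t with
  | RInl s => RInl (rlam_nf s)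
  | RInr s => RInr (rlam_nf s)
  | _ => RLam t
  end.

(** [ev s tss t]: head evaluation of [rapps s tss] can reach the normal form [t]. *)
Inductive ev : rterm -> list (list rterm) -> rterm -> Prop :=
| ev_var x tss uss : ev_stack tss uss -> ev (RVar x) tss (rapps (RVar x) uss)
| ev_app s ts tss t : ev s (ts :: tss) t -> ev (RApp s ts) tss t
| ev_lam s t : ev s [] t -> ev (RLam s) [] (rlam_nf t)
| ev_beta s ts tss r t : lsub 0 s ts r -> ev r tss t -> ev (RLam s) (ts :: tss) t
| ev_inl s tss t : ev s tss t -> ev (RInl s) tss (RInl t)
| ev_inr s tss t : ev s tss t -> ev (RInr s) tss (RInr t)
with ev_stack : list (list rterm) -> list (list rterm) -> Prop :=
| ev_stack_nil : ev_stack [] []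
| ev_stack_cons ts us tss uss :
    ev_bag ts us -> ev_stack tss uss -> ev_stack (ts :: tss) (us :: uss)
with ev_bag : list rterm -> list rterm -> Prop :=
| ev_bag_nil : ev_bag [] []
| ev_bag_cons ts t l u us :
    Permutation ts (t :: l) -> ev t [] u -> ev_bag l us -> ev_bag ts (u :: us).

Scheme ev_mind := Minimality for ev Sort Prop
  with ev_stack_mind := Minimality for ev_stack Sort Prop
  with ev_bag_mind := Minimality for ev_bag Sort Prop.
Combined Scheme ev_mutind from ev_mind, ev_stack_mind, ev_bag_mind.

#[local] Hint Constructors ev ev_stack ev_bag : ev.

Inductive stack_red : list (list rterm) -> list (list rterm) -> Prop :=
| stack_red_head ts ts' tss : bag_red ts ts' -> stack_red (ts :: tss) (ts' :: tss)
| stack_red_tail ts tss tss' :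
    stack_red tss tss' -> stack_red (ts :: tss) (ts :: tss').

#[local] Hint Constructors stack_red : ev.

(** The two expansions need each other: [ev_app] turns a step in an argument into a step of the
    stack, and [ev_beta] turns a step of the stack into a step of the contractum. *)
Lemma ev_expand :
  (forall s tss t, ev s tss t ->
     (forall s', red s' s -> ev s' tss t) /\
     (forall tss', stack_red tss' tss -> ev s tss' t)) /\
  (forall tss uss, ev_stack tss uss ->
     forall tss', stack_red tss' tss -> ev_stack tss' uss) /\
  (forall ts us, ev_bag ts us -> forall ts', bag_red ts' ts -> ev_bag ts' us).
Proof.
  apply ev_mutind.
  - intros x tss uss H IH. split; [|auto with ev].
    intros s' Hr. inv Hr; eauto with ev.
  - intros s ts tss t H [IH1 IH2]. split; [|auto with ev].
    intros s' Hr. inv Hr; eauto with ev.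
    constructor. apply IH2. constructor. do 3 eexists. repeat split; eassumption.
  - intros s t H [IH _]. split; [|intros tss' Hr; inv Hr].
    intros s' Hr. inv Hr; eauto with ev.
  - intros s ts tss r t Hs H [IH1 IH2]. split.
    + intros s' Hr. inv Hr; eauto with ev.
      edestruct red_lsub as (r' & Hr' & Hrr); [eassumption..|]. eauto with ev.
    + intros tss' Hr. inv Hr; [|eauto with ev].
      edestruct lsub_bag_red as (r' & Hr' & Hrr); [eassumption..|]. eauto with ev.
  - intros s tss t H [IH1 IH2]. split; [|auto with ev].
    intros s' Hr. inv Hr; auto with ev.
    + eauto with ev.
    + inv H; auto with ev.
    (* The choice was pulled out of an abstraction. On an empty stack, [rlam_nf] makes the same
       exchange on the normal form; on a nonempty one, the substitution goes through the choice. *)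
    + inv H.
      * change (RInl (rlam_nf t0)) with (rlam_nf (RInl t0)). auto with ev.
      * eauto with ev lsub.
  - intros s tss t H [IH1 IH2]. split; [|auto with ev].
    intros s' Hr. inv Hr; auto with ev.
    + eauto with ev.
    + inv H; auto with ev.
    + inv H.
      * change (RInr (rlam_nf t0)) with (rlam_nf (RInr t0)). auto with ev.
      * eauto with ev lsub.
  - intros tss' Hr. inv Hr.
  - intros ts us tss uss H1 IH1 H2 IH2 tss' Hr. inv Hr; auto with ev.
  - intros ts' (u' & u & l & _ & _ & P). now apply Permutation_nil_cons in P.
  - intros ts t l u us P Ht IHt Hl IHl ts' (a' & a & m & Ha & P1 & P2).
    rewrite P in P2. apply perm_cons_cons in P2 as [[<- P2]|(k & P2 & P3)].
    + rewrite <- P2 in P1. econstructor; [exact P1| |exact Hl]. now apply IHt.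
    + apply (ev_bag_cons _ t (a' :: k)); [rewrite P1, P3; perm|exact Ht|].
      apply IHl. exists a', a, k. auto.
Qed.

Definition reds : rterm -> rterm -> Prop := clos_refl_trans_1n rterm red.

Lemma ev_reds s s' tss t : reds s s' -> ev s' tss t -> ev s tss t.
Proof.
  induction 1 as [|s s1 s' H _ IH]; [trivial|].
  intros Hs. apply IH in Hs. now apply (proj1 ev_expand _ _ _ Hs).
Qed.

(** * Normal resource terms *)

Definition normal (t : rterm) : Prop := forall E, ~ rstep t E.

Definition rneutral (t : rterm) : bool :=
  match t with RVar _ | RApp _ _ => true | _ => false end.

Lemma normal_lam s : normal (RLam s) -> normal s /\ rlam_nf s = RLam s.
Proof.
  intros H. split.
  - intros E HE. eapply H. constructor. exact HE.
  - destruct s; try reflexivity; exfalso; eapply H; constructor.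
Qed.

Lemma normal_app s ts :
  normal (RApp s ts) -> normal s /\ rneutral s = true /\ Forall normal ts.
Proof.
  intros H. repeat split.
  - intros E HE. eapply H. apply rstep_fun. exact HE.
  - destruct s; try reflexivity; exfalso; eapply H; constructor.
  - apply Forall_forall. intros t Ht E HE.
    apply in_split in Ht as (ts1 & ts2 & ->). eapply H. apply rstep_arg. exact HE.
Qed.

(** The second conjunct serves the application case, where the function part is evaluated on a
    nonempty stack; neutrality excludes any interaction with that stack. *)
Lemma normal_ev t :
  normal t ->
  ev t [] t /\
  (rneutral t = true ->
   forall tss uss, ev_stack tss uss -> ev t tss (rapps t uss)).
Proof.
  induction t as [x|s IH|s ts IHs IHts|s IH|s IH] using rterm_nested_ind; intros H.
  - split; intros; [apply (ev_var x [] [])|apply ev_var]; auto with ev.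
  - apply normal_lam in H as [H E]. split; [|discriminate].
    rewrite <- E at 2. apply ev_lam. now apply IH.
  - apply normal_app in H as (H1 & H2 & H3).
    assert (Hts : ev_bag ts ts).
    { clear - IHts H3. induction ts as [|t ts IH]; [constructor|].
      inv IHts. inv H3. apply (ev_bag_cons _ t ts); auto. now apply H1. }
    destruct (IHs H1) as [_ IH]. split; intros; apply ev_app.
    + apply (IH H2 _ [ts]). auto with ev.
    + apply (IH H2 _ (ts :: uss)). auto with ev.
  - split; [|discriminate]. constructor. apply IH.
    intros E HE. eapply H. apply rstep_inl. exact HE.
  - split; [|discriminate]. constructor. apply IH.
    intros E HE. eapply H. apply rstep_inr. exact HE.
Qed.

(** * From sums to nondeterministic paths *)

(** [k] must be bound outside the fixpoint for [rsubst_app] to hold by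
    conversion. *)
Section rsubst_bag.
  Variable k : nat.

  Fixpoint rsubst_bag (ts us : list rterm) : list (list rterm) :=
    match ts with
    | [] => match us with [] => [[]] | _ => [] end
    | t :: ts =>
        flat_map (fun p =>
          flat_map (fun t' => map (cons t') (rsubst_bag ts (snd p)))
            (rsubst k t (fst p)))
          (splits us)
    end.
End rsubst_bag.

Lemma rsubst_app k s ts us :
  rsubst k (RApp s ts) us =
  flat_map (fun p =>
    flat_map (fun s' => map (RApp s') (rsubst_bag k ts (snd p)))
      (rsubst k s (fst p)))
    (splits us).
Proof. reflexivity. Qed.

Lemma in_splits_perm {A} (l : list A) p :
  In p (splits l) -> Permutation l (fst p ++ snd p).
Proof.
  revert p. induction l as [|u l IH]; simpl; intros p H.
  - destruct H as [<-|[]]. reflexivity.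
  - apply in_flat_map in H as (q & Hq & [<-|[<-|[]]]); simpl;
      rewrite (IH _ Hq); [reflexivity|apply Permutation_middle].
Qed.

Lemma in_splits_app {A} (l1 l2 : list A) : In (l1, l2) (splits (l1 ++ l2)).
Proof.
  induction l1 as [|u l1 IH]; simpl.
  - induction l2 as [|u l2 IH]; simpl; [now left|].
    apply in_flat_map. exists ([], l2). simpl. auto.
  - apply in_flat_map. exists (l1, l2). simpl. auto.
Qed.

Lemma in_rsubst_lsub s k us r : In r (rsubst k s us) -> lsub k s us r.
Proof.
  revert k us r. induction s as [x|s IH|s ts IHs IHts|s IH|s IH]
    using rterm_nested_ind; intros k us r H.
  - simpl in H. destruct (Nat.compare_spec x k), us as [|u [|]];
      simpl in H; try contradiction; destruct H as [<-|[]]; subst;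
      now constructor.
  - apply in_map_iff in H as (r' & <- & H). constructor. auto.
  - assert (Hbag : forall us rs, In rs (rsubst_bag k ts us) -> lsubs k ts us rs).
    { clear - IHts. induction IHts as [|t ts Ht _ IH]; simpl; intros us rs H.
      - destruct us; [|contradiction]. destruct H as [<-|[]]. constructor.
      - apply in_flat_map in H as (p & Hp & H).
        apply in_flat_map in H as (t' & Ht' & H).
        apply in_map_iff in H as (rs' & <- & H).
        econstructor; [apply in_splits_perm; exact Hp|auto..]. }
    rewrite rsubst_app in H.
    apply in_flat_map in H as (p & Hp & H).
    apply in_flat_map in H as (t' & Ht' & H).
    apply in_map_iff in H as (rs' & <- & H).
    econstructor; [apply in_splits_perm; exact Hp|auto..].
  - apply in_map_iff in H as (r' & <- & H). constructor. auto.
  - apply in_map_iff in H as (r' & <- & H). constructor. auto.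
Qed.

Lemma rstep_red e E e' : rstep e E -> In e' E -> red e e'.
Proof.
  intros H. revert e'. induction H; intros e' He';
    repeat match goal with
    | H : In _ (map _ _) |- _ => apply in_map_iff in H as (? & <- & ?)
    | H : In _ [_] |- _ => destruct H as [<-|[]]
    end; auto with red.
  - constructor. now apply in_rsubst_lsub.
  - eapply red_arg; [apply IHrstep; eassumption|..];
      symmetry; apply Permutation_middle.
Qed.

(** Reordering bags hides no redex. Only the existence of a step is transported, which is enough to
    make normality a property of classes. *)
Lemma req_reducible e f E : req e f -> rstep e E -> exists E', rstep f E'.
Proof.
  intros Hef H. revert f Hef.
  induction H; intros f Hef; inv Hef;
    try match goal with H : req (_ _) _ |- _ => inv H end;
    try match goal with
    | IH : forall f, req ?s f -> _, H : req ?s _ |- _ =>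
        destruct (IH _ H) as [E' HE']
    end;
    try (eexists; econstructor; eassumption).
  assert (Ht : InA req t ts').
  { eapply PermutationA_equivlistA; [exact req_equiv|symmetry; eassumption|].
    apply InA_app_iff. right. now left. }
  apply InA_alt in Ht as (t' & Ht & Hin).
  apply in_split in Hin as (l1 & l2 & ->).
  destruct (IHrstep _ Ht) as [E' HE']. eexists. apply rstep_arg. exact HE'.
Qed.

Lemma normal_req s t : req s t -> normal s -> normal t.
Proof.
  intros Hst Hs E HE. symmetry in Hst.
  destruct (req_reducible _ _ _ Hst HE) as [E' HE']. now apply (Hs E').
Qed.

Lemma supp_rsum_eq E F t : rsum_eq E F -> supp E t -> supp F t.
Proof.
  unfold supp. rewrite <- !InA_altdef. intros H.
  now apply (PermutationA_equivlistA req_equiv H).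
Qed.

Lemma sum_normal_iff F : sum_normal F <-> Forall normal F.
Proof.
  split.
  - intros H. apply Forall_forall. intros f Hf E HE.
    apply in_split in Hf as (F1 & F2 & ->).
    apply (H (E ++ (F1 ++ F2))). exists f E (F1 ++ F2); [|exact HE|reflexivity].
    symmetry. apply (PermutationA_middle req_equiv).
  - intros H G HG. inv HG.
    assert (He : supp F e).
    { eapply supp_rsum_eq; [symmetry; eassumption|]. now left. }
    apply Exists_exists in He as (f & Hf & Hef).
    destruct (req_reducible _ _ _ Hef H1) as [E HE].
    rewrite Forall_forall in H. exact (H f Hf E HE).
Qed.

(** The relation is arbitrary because both [red] and [pick_step] are closed under contexts. *)
Lemma star_map (R : relation rterm) (f : rterm -> rterm) s t :
  (forall s t, R s t -> R (f s) (f t)) ->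
  clos_refl_trans_1n _ R s t -> clos_refl_trans_1n _ R (f s) (f t).
Proof. intros Hf. induction 1; econstructor; eauto. Qed.

Lemma star_trans (R : relation rterm) s t u :
  clos_refl_trans_1n _ R s t -> clos_refl_trans_1n _ R t u ->
  clos_refl_trans_1n _ R s u.
Proof. induction 1; [trivial|]. econstructor; eauto. Qed.

Lemma star_bag (R : relation rterm) (f : list rterm -> rterm) ts ts' :
  (forall l1 l2 t t', R t t' -> R (f (l1 ++ t :: l2)) (f (l1 ++ t' :: l2))) ->
  Forall2 (clos_refl_trans_1n _ R) ts ts' ->
  clos_refl_trans_1n _ R (f ts) (f ts').
Proof.
  intros Hf H. change ts with ([] ++ ts). change ts' with ([] ++ ts').
  (* The generalized prefix collects the elements that are already reduced. *)
  generalize (@nil rterm). induction H as [|t t' ts ts' Ht _ IH]; intros l.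
  - constructor.
  - apply star_trans with (f (l ++ t' :: ts)).
    + now apply (star_map R (fun t => f (l ++ t :: ts))); [apply Hf|].
    + specialize (IH (l ++ [t'])). now rewrite <- !app_assoc in IH.
Qed.

(** Changing representatives is absorbed into paths, thanks to the reordering allowed by
    [red_arg]. *)
Lemma req_reds s t : req s t -> reds s t.
Proof.
  revert t. induction s as [x|s IH|s ts IHs IHts|s IH|s IH]
    using rterm_nested_ind; intros t H; inv H.
  - constructor.
  - apply (star_map red RLam); [auto with red|now apply IH].
  - apply star_trans with (RApp s' ts).
    { apply (star_map red (fun s => RApp s ts)); [auto with red|now apply IHs]. }
    (* The bag is first reordered into [l], whose elements are then equivalent to those of the
       target one by one. *)
    apply PermutationA_decompose in H4 as (l & Hl & Hl'); [|exact req_equiv].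
    apply star_trans with (RApp s' l).
    (* Reordering by [red_arg] has to select some element for its reflexive step, hence the separate
       case of the empty bag. *)
    + destruct ts as [|t ts].
      * apply Permutation_nil in Hl as ->. constructor.
      * apply (Relation_Operators.rt1n_trans _ _ _ (RApp s' l)); [|constructor].
        apply red_arg with t t ts; [constructor|reflexivity|now symmetry].
    + rewrite Hl in IHts. clear - IHts Hl'. apply star_bag.
      * intros l1 l2 t t' H.
        eapply red_arg; [exact H|..]; symmetry; apply Permutation_middle.
      * unfold reds in IHts. induction Hl'; inv IHts; constructor; auto.
  - apply (star_map red RInl); [auto with red|now apply IH].
  - apply (star_map red RInr); [auto with red|now apply IH].
Qed.

(** Read backwards, a step of sums gives each summand of the result an ancestor, up to [req]: either
    itself or the term that was reduced. *)
Lemma sum_steps_reds G F t :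
  clos_refl_trans _ sum_step G F -> supp F t -> exists s, supp G s /\ reds s t.
Proof.
  intros H%clos_rt_rt1n. revert t. induction H as [G|G G' F H _ IH]; intros t Ht.
  - exists t. split; [assumption|constructor].
  - destruct (IH _ Ht) as (s & Hs & Hst). destruct H as [G e E F0 G' HG He HG'].
    apply (supp_rsum_eq _ _ _ HG') in Hs. apply Exists_app in Hs as [Hs|Hs].
    + apply Exists_exists in Hs as (e' & He' & Hse). exists e. split.
      * apply (supp_rsum_eq (e :: F0)); [now symmetry|]. now left.
      * econstructor; [eapply rstep_red; eassumption|].
        apply star_trans with s; [|exact Hst]. apply req_reds. now symmetry.
    + exists s. split; [|exact Hst].
      apply (supp_rsum_eq (e :: F0)); [now symmetry|]. now right.
Qed.

(** A normal term evaluates to itself, and evaluation is stable under expansion along the path from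
    [e]. *)
Lemma is_NF_ev e F t : is_NF [e] F -> supp F t -> ev e [] t.
Proof.
  intros [H HF] Ht. destruct (sum_steps_reds _ _ _ H Ht) as (s & Hs & Hst).
  apply Exists_cons in Hs as [Hs|Hs]; [|inv Hs].
  apply ev_reds with s; [apply req_reds; now symmetry|].
  apply ev_reds with t; [exact Hst|]. apply normal_ev.
  apply sum_normal_iff in HF. apply Exists_exists in Ht as (f & Hf & Htf).
  rewrite Forall_forall in HF. apply normal_req with f; [now symmetry|auto].
Qed.

(** * Termination *)

(** Multiplicativity in bags makes the measure of [rsubst k s us] at most
    [rmeasure s * bag_measure us]; abstractions and applications weigh more
    than the choices they commute with. *)
Fixpoint rmeasure (t : rterm) : nat :=
  match t with
  | RVar _ => 1
  | RLam s => 2 * rmeasure s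
  | RApp s ts => 2 * rmeasure s * fold_right (fun t n => rmeasure t * n) 1 ts
  | RInl s | RInr s => S (rmeasure s)
  end.

Definition bag_measure (ts : list rterm) : nat :=
  fold_right (fun t n => rmeasure t * n) 1 ts.

Lemma bag_measure_app ts us :
  bag_measure (ts ++ us) = bag_measure ts * bag_measure us.
Proof. induction ts; simpl; lia. Qed.

Lemma bag_measure_perm ts us :
  Permutation ts us -> bag_measure ts = bag_measure us.
Proof. induction 1; simpl; lia. Qed.

Lemma rmeasure_pos t : 0 < rmeasure t.
Proof.
  induction t as [x|s IH|s ts IHs IHts|s IH|s IH] using rterm_nested_ind;
    simpl; try lia.
  assert (0 < fold_right (fun t n => rmeasure t * n) 1 ts); [|lia].
  induction IHts; simpl; lia.
Qed.

Lemma bag_measure_pos ts : 0 < bag_measure ts.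
Proof.
  induction ts as [|t ts IH]; simpl; [lia|]. pose proof (rmeasure_pos t). lia.
Qed.

Lemma rmeasure_rlift c t : rmeasure (rlift c t) = rmeasure t.
Proof.
  revert c. induction t as [x|s IH|s ts IHs IHts|s IH|s IH]
    using rterm_nested_ind; intros c; simpl; rewrite ?IH, ?IHs; try reflexivity.
  f_equal. induction IHts; simpl; congruence.
Qed.

Lemma lsub_lsubs_measure :
  (forall k s us r, lsub k s us r -> rmeasure r <= rmeasure s * bag_measure us) /\
  (forall k ts us rs, lsubs k ts us rs ->
     bag_measure rs <= bag_measure ts * bag_measure us).
Proof.
  apply lsub_mutind; simpl; intros; try lia.
  - replace (bag_measure us) with (bag_measure (map (rlift 0) us)); [lia|].
    clear. induction us; simpl; [|rewrite rmeasure_rlift]; congruence.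
  - rewrite (bag_measure_perm _ _ H), bag_measure_app.
    change (fold_right _ 1 ?l) with (bag_measure l). nia.
  (* The extra 1 of a choice is multiplied by the measure of the bag, which is at least 1. *)
  - pose proof (bag_measure_pos us). nia.
  - pose proof (bag_measure_pos us). nia.
  - rewrite (bag_measure_perm _ _ H), bag_measure_app. nia.
Qed.

(** A beta step drops the factors 2 of the abstraction and of the application; a choice that moves
    outwards contributes 1 where it contributed at least 2. *)
Lemma rstep_measure e E e' : rstep e E -> In e' E -> rmeasure e' < rmeasure e.
Proof.
  intros H. revert e'. induction H; intros e' He';
    repeat match goal with
    | H : In _ (map _ _) |- _ => apply in_map_iff in H as (? & <- & ?)
    | H : In _ [_] |- _ => destruct H as [<-|[]]
    end; simpl; change (fold_right (fun t n => rmeasure t * n) 1) with bag_measure;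
    rewrite ?bag_measure_app; simpl;
    repeat match goal with
    | H : forall e', In e' ?E -> _, H' : In _ ?E |- _ => specialize (H _ H')
    end.
  - apply in_rsubst_lsub in He'. apply lsub_lsubs_measure in He'.
    pose proof (rmeasure_pos s). pose proof (bag_measure_pos ts). nia.
  - pose proof (bag_measure_pos ts). nia.
  - pose proof (bag_measure_pos ts). nia.
  - lia.
  - lia.
  - lia.
  - pose proof (bag_measure_pos ts). nia.
  - pose proof (rmeasure_pos s).
    apply Nat.mul_lt_mono_pos_l; [lia|].
    apply Nat.mul_lt_mono_pos_l; [apply bag_measure_pos|].
    apply Nat.mul_lt_mono_pos_r; [apply bag_measure_pos|assumption].
  - lia.
  - lia.
Qed.

Lemma reducible_or_normal t : (exists E, rstep t E) \/ normal t.
Proof.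
  induction t as [x|s IH|s ts IHs IHts|s IH|s IH] using rterm_nested_ind.
  - right. intros E H. inv H.
  - destruct IH as [[E HE]|IH]; [left; eexists; constructor; eassumption|].
    destruct s; try (left; eexists; constructor; fail);
      right; intros E H; inv H; eapply IH; eassumption.
  - destruct IHs as [[E HE]|IHs]; [left; eexists; apply rstep_fun; eassumption|].
    assert (Hts : (exists l1 t l2 E, ts = l1 ++ t :: l2 /\ rstep t E) \/
                  Forall normal ts).
    { clear IHs. induction IHts as [|t ts [[E HE]|Ht] _ IH]; [auto| |].
      - left. now exists [], t, ts, E.
      - destruct IH as [(l1 & u & l2 & E & -> & HE)|IH]; [|auto].
        left. now exists (t :: l1), u, l2, E. }
    destruct Hts as [(l1 & u & l2 & E & -> & HE)|Hts].
    { left. eexists. apply rstep_arg. exact HE. }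
    destruct s; try (left; eexists; constructor; fail); right; intros E H; inv H;
      try (eapply IHs; eassumption);
      rewrite Forall_app in Hts; destruct Hts as [_ Hts]; inv Hts;
      match goal with H : normal ?t, H' : rstep ?t _ |- _ => exact (H _ H') end.
  - destruct IH as [[E HE]|IH]; [left; eexists; constructor; eassumption|].
    right; intros E H; inv H. eapply IH; eassumption.
  - destruct IH as [[E HE]|IH]; [left; eexists; constructor; eassumption|].
    right; intros E H; inv H. eapply IH; eassumption.
Qed.

Lemma sum_step_app_l A G G' : sum_step G G' -> sum_step (A ++ G) (A ++ G').
Proof.
  intros [G0 e E F G0' HG He HG']. exists e E (A ++ F); [|exact He|].
  - transitivity (A ++ e :: F); [now apply (PermutationA_app_head req_equiv)|].
    symmetry. apply (PermutationA_middle req_equiv).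
  - transitivity (A ++ E ++ F); [now apply (PermutationA_app_head req_equiv)|].
    rewrite !app_assoc. apply (PermutationA_app_tail req_equiv).
    apply (PermutationA_app_comm req_equiv).
Qed.

Lemma sum_step_app_r A G G' : sum_step G G' -> sum_step (G ++ A) (G' ++ A).
Proof.
  intros [G0 e E F G0' HG He HG']. exists e E (F ++ A); [|exact He|].
  - change (e :: F ++ A) with ((e :: F) ++ A). now apply (PermutationA_app_tail req_equiv).
  - rewrite app_assoc. now apply (PermutationA_app_tail req_equiv).
Qed.

Lemma sum_steps_app G G' H H' :
  clos_refl_trans _ sum_step G G' -> clos_refl_trans _ sum_step H H' ->
  clos_refl_trans _ sum_step (G ++ H) (G' ++ H').
Proof.
  intros HG HH. apply rt_trans with (G' ++ H).
  - induction HG; [apply rt_step, sum_step_app_r; assumption|apply rt_refl|].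
    eapply rt_trans; eassumption.
  - induction HH; [apply rt_step, sum_step_app_l; assumption|apply rt_refl|].
    eapply rt_trans; eassumption.
Qed.

Lemma rstep_sum_step e E : rstep e E -> sum_step [e] E.
Proof.
  intros H. exists e E []; [reflexivity|exact H|]. rewrite app_nil_r. reflexivity.
Qed.

Definition normalizes (E : rsum) : Prop :=
  exists F, clos_refl_trans _ sum_step E F /\ Forall normal F.

Lemma normalizes_sum E : (forall e, In e E -> normalizes [e]) -> normalizes E.
Proof.
  induction E as [|e E IH]; intros H.
  - exists []. split; [apply rt_refl|constructor].
  - destruct (H e (or_introl eq_refl)) as (F & HF & NF).
    destruct IH as (F' & HF' & NF'); [intros; apply H; now right|].
    exists (F ++ F'). split; [|now apply Forall_app].
    exact (sum_steps_app [e] F E F' HF HF').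
Qed.

(** Summands reduce independently, so induction on the measure of a single term suffices. *)
Lemma weak_normalization E : normalizes E.
Proof.
  apply normalizes_sum. intros e _.
  induction e as [e IH] using (well_founded_induction (well_founded_ltof _ rmeasure)).
  destruct (reducible_or_normal e) as [[E' HE]|He].
  - destruct (normalizes_sum E') as (F & HF & NF).
    + intros e' He'. apply IH. eapply rstep_measure; eassumption.
    + exists F. split; [|exact NF].
      eapply rt_trans; [apply rt_step, rstep_sum_step; exact HE|exact HF].
  - exists [e]. split; [apply rt_refl|auto].
Qed.

(** * Paths from the Taylor support of a term *)

(** In contrast with [red], this is neither reflexive nor closed under reordering: each step is an
    actual reduction that can be replayed on sums. *)
Definition pick_step (e e' : rterm) : Prop := exists E, rstep e E /\ In e' E.

Definition pick_steps : relation rterm := clos_refl_trans_1n _ pick_step.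

(** The summands that the path discards are normalized on their own, and without cancellation they
    cannot remove [t]. *)
Lemma pick_steps_NF e t :
  pick_steps e t -> normal t -> exists F, is_NF [e] F /\ In t F.
Proof.
  intros H Ht. induction H as [t|e e' t (E & HE & He') _ IH].
  - exists [t]. split; [|now left]. split; [apply rt_refl|].
    apply sum_normal_iff. auto.
  - destruct (IH Ht) as (F & (HF & NF) & HtF).
    apply in_split in He' as (E1 & E2 & ->).
    destruct (weak_normalization E1) as (F1 & HF1 & NF1).
    destruct (weak_normalization E2) as (F2 & HF2 & NF2).
    exists (F1 ++ F ++ F2). split; [split|].
    + eapply rt_trans; [apply rt_step, rstep_sum_step; exact HE|].
      exact (sum_steps_app _ _ _ _ HF1 (sum_steps_app [e'] _ _ _ HF HF2)).
    + apply sum_normal_iff. apply sum_normal_iff in NF.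
      rewrite !Forall_app. auto.
    + rewrite !in_app_iff. auto.
Qed.

Lemma pick_steps_lam s t : pick_steps s t -> pick_steps (RLam s) (RLam t).
Proof.
  apply star_map. intros ? ? (E & HE & Hin). exists (map RLam E).
  split; [now constructor|now apply in_map].
Qed.

Lemma pick_steps_inl s t : pick_steps s t -> pick_steps (RInl s) (RInl t).
Proof.
  apply star_map. intros ? ? (E & HE & Hin). exists (map RInl E).
  split; [now constructor|now apply in_map].
Qed.

Lemma pick_steps_inr s t : pick_steps s t -> pick_steps (RInr s) (RInr t).
Proof.
  apply star_map. intros ? ? (E & HE & Hin). exists (map RInr E).
  split; [now constructor|now apply in_map].
Qed.

Lemma pick_steps_app s s' ts ts' :
  pick_steps s s' -> Forall2 pick_steps ts ts' ->
  pick_steps (RApp s ts) (RApp s' ts').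
Proof.
  intros Hs Hts. apply star_trans with (RApp s' ts).
  - apply (star_map pick_step (fun s => RApp s ts)); [|exact Hs].
    intros u v (E & HE & Hin). exists (map (fun s => RApp s ts) E).
    split; [now constructor|now apply (in_map (fun s => RApp s ts))].
  - apply star_bag; [|exact Hts].
    intros l1 l2 u v (E & HE & Hin).
    exists (map (fun t => RApp s' (l1 ++ t :: l2)) E).
    split; [now apply rstep_arg|now apply (in_map (fun t => RApp s' (l1 ++ t :: l2)))].
Qed.

Lemma pick_steps_root e E t : rstep e E -> In t E -> pick_steps e t.
Proof.
  intros HE Ht. apply (Relation_Operators.rt1n_trans _ _ _ t); [|constructor].
  now exists E.
Qed.

(** * Taylor supports and substitution *)

Lemma taylor_lift (N : term) c u : taylor N u -> taylor (lift c N) (rlift c u).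
Proof.
  revert c u. induction N as [x|N IH|P IHP Q IHQ|P IHP Q IHQ]; simpl;
    intros c u H; inv H; simpl; constructor; auto.
  apply Forall_map. eapply Forall_impl; [|eassumption]. auto.
Qed.

Lemma Forall_map_inv {A B} (f : A -> B) (P : A -> Prop) l :
  Forall (fun y => exists x, P x /\ y = f x) l ->
  exists l', Forall P l' /\ l = map f l'.
Proof.
  induction 1 as [|y l (x & Hx & ->) _ (l' & Hl' & ->)].
  - now exists [].
  - exists (x :: l'). auto.
Qed.

Lemma taylor_lift_inv (N : term) c t :
  taylor (lift c N) t -> exists u, taylor N u /\ t = rlift c u.
Proof.
  revert c t. induction N as [x|N IH|P IHP Q IHQ|P IHP Q IHQ]; simpl; intros c t H;
    inversion H as [|? s Hs|? ? s ts Hs Hts|? ? s Hs|? ? s Hs]; subst.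
  - exists (RVar x). split; [constructor|reflexivity].
  - destruct (IH _ _ Hs) as (u & Hu & ->).
    exists (RLam u). split; [now constructor|reflexivity].
  - destruct (IHP _ _ Hs) as (u & Hu & ->).
    destruct (Forall_map_inv (rlift c) (taylor Q) ts) as (us & Hus & ->).
    { eapply Forall_impl; [|exact Hts]. auto. }
    exists (RApp u us). split; [now constructor|reflexivity].
  - destruct (IHP _ _ Hs) as (u & Hu & ->).
    exists (RInl u). split; [now constructor|reflexivity].
  - destruct (IHQ _ _ Hs) as (u & Hu & ->).
    exists (RInr u). split; [now constructor|reflexivity].
Qed.

(** With [taylor_subst_inv], this describes the Taylor support of a substitution: every occurrence
    of the variable receives its own resource from the support of [N]. *)
Lemma taylor_lsub (M : term) k (N : term) s us r :
  taylor M s -> Forall (taylor N) us -> lsub k s us r -> taylor (subst k N M) r.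
Proof.
  revert k N s us r. induction M as [x|M IH|P IHP Q IHQ|P IHP Q IHQ]; simpl;
    intros k N s us r Hs Hus H;
    inversion Hs as [|? s' Hs'|? ? s' ts Hs' Hts|? ? s' Hs'|? ? s' Hs']; subst.
  - destruct (Nat.compare_spec x k); inv H; try lia; try constructor.
    now inv Hus.
  - inv H. constructor. eapply IH; [eassumption| |eassumption].
    apply Forall_map. eapply Forall_impl; [|exact Hus]. intros; now apply taylor_lift.
  - inversion H as [| | | |? ? ? ? us1 us2 r0 rs Hp H1 Hrs| |]; subst.
    rewrite Hp in Hus. apply Forall_app in Hus as [Hus1 Hus2].
    constructor; [eauto|].
    clear - Hrs Hus2 Hts IHQ. revert us2 rs Hus2 Hrs.
    induction Hts as [|t ts Ht _ IH]; intros us rs Hus Hrs.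
    + inv Hrs. constructor.
    + inversion Hrs as [|? ? ? ? vs1 vs2 r rs' Hp H1 H2]; subst.
      rewrite Hp in Hus. apply Forall_app in Hus as [Hus1 Hus2].
      constructor; eauto.
  - inv H. constructor. eauto.
  - inv H. constructor. eauto.
Qed.

Lemma taylor_subst_inv (M : term) k (N : term) t :
  taylor (subst k N M) t ->
  exists s us, taylor M s /\ Forall (taylor N) us /\ In t (rsubst k s us).
Proof.
  revert k N t. induction M as [x|M IH|P IHP Q IHQ|P IHP Q IHQ]; simpl;
    intros k N t H.
  - exists (RVar x). destruct (Nat.compare_spec x k).
    + exists [t]. subst. repeat split; [constructor|auto|].
      simpl. rewrite Nat.compare_refl. now left.
    + exists []. inv H. repeat split; [constructor|constructor|]. simpl.
      rewrite (proj2 (Nat.compare_lt_iff x k)) by assumption. now left.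
    + exists []. inv H. repeat split; [constructor|constructor|]. simpl.
      rewrite (proj2 (Nat.compare_gt_iff x k)) by assumption. now left.
  - inversion H as [|? t' Ht| | |]; subst.
    destruct (IH _ _ _ Ht) as (s & us & Hs & Hus & Hin).
    destruct (Forall_map_inv (rlift 0) (taylor N) us) as (vs & Hvs & ->).
    { eapply Forall_impl; [|exact Hus]. intros u. apply taylor_lift_inv. }
    exists (RLam s), vs. repeat split; [now constructor|exact Hvs|].
    now apply in_map.
  - inversion H as [| |? ? p ts HP HQ| |]; subst.
    destruct (IHP _ _ _ HP) as (s & us & Hs & Hus & Hin).
    assert (Hbag : exists ss vs, Forall (taylor Q) ss /\ Forall (taylor N) vs /\
                     In ts (rsubst_bag k ss vs)).
    { clear - HQ IHQ. induction HQ as [|t ts Ht _ (ss & vs & Hss & Hvs & Hin)].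
      - exists [], []. repeat split; auto. now left.
      - destruct (IHQ _ _ _ Ht) as (s & us & Hs & Hus & Hin').
        (* The resources are concatenated so that [(us, vs)] is among the enumerated splits. *)
        exists (s :: ss), (us ++ vs). repeat split; [auto|now apply Forall_app|].
        simpl. apply in_flat_map. exists (us, vs). split; [apply in_splits_app|].
        apply in_flat_map. exists t. split; [assumption|]. now apply in_map. }
    destruct Hbag as (ss & vs & Hss & Hvs & Hin').
    exists (RApp s ss), (us ++ vs).
    repeat split; [now constructor|now apply Forall_app|].
    rewrite rsubst_app. apply in_flat_map. exists (us, vs).
    split; [apply in_splits_app|].
    apply in_flat_map. exists p. split; [assumption|]. now apply in_map.
  - inversion H as [| | |? ? t' Ht|? ? t' Ht]; subst.
    + destruct (IHP _ _ _ Ht) as (s & us & Hs & Hus & Hin).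
      exists (RInl s), us. repeat split; [now constructor|exact Hus|now apply in_map].
    + destruct (IHQ _ _ _ Ht) as (s & us & Hs & Hus & Hin).
      exists (RInr s), us. repeat split; [now constructor|exact Hus|now apply in_map].
Qed.

(** * Simulation of head reduction by resource reduction *)

Lemma head_red_lam M :
  (exists P Q, M = Plus P Q) \/ head_red (Lam M) = Lam (head_red M).
Proof. destruct M; eauto. Qed.

Lemma head_red_app P Q :
  (exists P1 P2, P = Plus P1 P2) \/ (exists P', P = Lam P') \/
  head_red (App P Q) = App (head_red P) (if neutral P then head_red Q else Q).
Proof. destruct P; eauto. Qed.

Lemma Forall_exists_Forall2 {A B} (P : A -> Prop) (R : A -> B -> Prop) l :
  Forall (fun y => exists x, P x /\ R x y) l ->
  exists l', Forall P l' /\ Forall2 R l' l.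
Proof.
  induction 1 as [|y l (x & Hx & HR) _ (l' & Hl' & HR')].
  - now exists [].
  - exists (x :: l'). auto.
Qed.

(** Each clause of [head_red] is simulated by resource steps. Their number varies, since the
    elements of the bags below a neutral head are reduced separately. *)
Lemma taylor_head_red (M : term) t :
  taylor (head_red M) t -> exists e, taylor M e /\ pick_steps e t.
Proof.
  revert t. induction M as [x|M IH|P IHP Q IHQ|P IHP Q IHQ]; intros t H.
  - exists t. split; [exact H|constructor].
  - destruct (head_red_lam M) as [(P & Q & ->)|E].
    + inversion H as [| | |? ? s Hs|? ? s Hs]; subst; inv Hs.
      * eexists. split; [do 2 constructor; eassumption|].
        eapply pick_steps_root; [constructor|now left].
      * eexists. split; [constructor; apply taylor_inr; eassumption|].
        eapply pick_steps_root; [constructor|now left].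
    + rewrite E in H. inversion H as [|? t' Ht| | |]; subst.
      destruct (IH _ Ht) as (e & He & Het).
      exists (RLam e). split; [now constructor|now apply pick_steps_lam].
  - destruct (head_red_app P Q) as [(P1 & P2 & ->)|[(P' & ->)|E]].
    + inversion H as [| | |? ? s Hs|? ? s Hs]; subst; inv Hs.
      * eexists. split; [constructor; [apply taylor_inl|]; eassumption|].
        eapply pick_steps_root; [constructor|now left].
      * eexists. split; [constructor; [apply taylor_inr|]; eassumption|].
        eapply pick_steps_root; [constructor|now left].
    + destruct (taylor_subst_inv _ _ _ _ H) as (s & us & Hs & Hus & Hin).
      exists (RApp (RLam s) us). split; [repeat constructor; assumption|].
      eapply pick_steps_root; [apply rstep_beta|exact Hin].
    + rewrite E in H. inversion H as [| |? ? t' ts Ht Hts| |]; subst.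
      destruct (IHP _ Ht) as (e & He & Het).
      destruct (Forall_exists_Forall2 (taylor Q) pick_steps ts)
        as (us & Hus & Huts).
      { eapply Forall_impl; [|exact Hts]. intros u Hu.
        destruct (neutral P); [now apply IHQ|].
        exists u. split; [exact Hu|constructor]. }
      exists (RApp e us). split; [now constructor|now apply pick_steps_app].
  - inversion H as [| | |? ? t' Ht|? ? t' Ht]; subst.
    + destruct (IHP _ Ht) as (e & He & Het).
      exists (RInl e). split; [now constructor|now apply pick_steps_inl].
    + destruct (IHQ _ Ht) as (e & He & Het).
      exists (RInr e). split; [now constructor|now apply pick_steps_inr].
Qed.

Lemma taylor_iter_head_red n (M : term) t :
  taylor (Nat.iter n head_red M) t -> exists e, taylor M e /\ pick_steps e t.
Proof.
  revert t. induction n as [|n IH]; intros t H.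
  - exists t. split; [exact H|constructor].
  - destruct (taylor_head_red _ _ H) as (e & He & Het).
    destruct (IH _ He) as (e' & He' & Hee'). exists e'.
    split; [exact He'|]. now apply star_trans with e.
Qed.

(** * Elementary approximants of terms *)

Lemma taylor_eBT (M : term) t : taylor (eBT M) t -> taylor M t.
Proof.
  revert t. induction M as [x|M IH|P IHP Q IHQ|P IHP Q IHQ]; simpl; intros t H.
  - exact H.
  - destruct (hnf M); inv H. constructor. auto.
  - destruct (neutral P); inv H. constructor; [auto|].
    eapply Forall_impl; [|eassumption]. auto.
  - inv H; constructor; auto.
Qed.

Lemma taylor_neutral_eBT M t :
  neutral M = true -> taylor (eBT M) t -> rneutral t = true.
Proof.
  destruct M; try discriminate; simpl; intros HM H.
  - now inv H.
  - rewrite HM in H. now inv H.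
Qed.

Lemma taylor_hnf_eBT M t :
  hnf M = true -> taylor (eBT M) t -> rlam_nf t = RLam t.
Proof.
  destruct M; try discriminate; simpl; intros HM H;
    rewrite ?HM in H; now inv H.
Qed.

(** The tests in [eBT] leave no abstraction or choice in function position and no choice directly
    under an abstraction. *)
Lemma taylor_eBT_normal M t : taylor (eBT M) t -> normal t.
Proof.
  revert t. induction M as [x|M IH|P IHP Q IHQ|P IHP Q IHQ]; simpl; intros t H.
  - inv H. intros E HE. inv HE.
  - destruct (hnf M) eqn:HM; inversion H as [|? s Hs| | |]; subst.
    pose proof (taylor_hnf_eBT _ _ HM Hs) as Hnf.
    intros E HE. inv HE; try discriminate. eapply IH; eassumption.
  - destruct (neutral P) eqn:HP; inversion H as [| |? ? s ts Hs Hts| |]; subst.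
    pose proof (taylor_neutral_eBT _ _ HP Hs) as Hn.
    intros E HE. inv HE; try discriminate.
    + eapply IHP; eassumption.
    + apply Forall_app in Hts as [_ Hts]. inv Hts. eapply IHQ; eassumption.
  - inv H; intros E HE; inv HE; [eapply IHP|eapply IHQ]; eassumption.
Qed.

Lemma taylor_le A B t : approx_le A B -> taylor A t -> taylor B t.
Proof.
  intros H. revert t. induction H; intros t Ht; auto; inv Ht; constructor; auto.
  eapply Forall_impl; [|eassumption]. auto.
Qed.

Lemma elementary_eBT M : elementary (eBT M).
Proof.
  (* [elementary] builds a whole head normal form at once, whereas [eBT] recurses on one constructor
     at a time; the strengthening keeps the head and its arguments explicit. *)
  enough (H : elementary (eBT M) /\
    (neutral M = true -> exists x Ns,
       Forall elementary Ns /\ eBT M = aapps (AVar x) Ns) /\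
    (hnf M = true -> exists n x Ns,
       Forall elementary Ns /\ eBT M = alams n (aapps (AVar x) Ns))) by apply H.
  induction M as [x|M (_ & _ & IH)|P (_ & IHP & _) Q (IHQ & _ & _)
                 |P (IHP & _ & _) Q (IHQ & _ & _)]; simpl.
  - repeat split.
    + exact (elem_hnf 0 x [] (Forall_nil _)).
    + intros _. exists x, []. auto.
    + intros _. exists 0, x, []. auto.
  - destruct (hnf M).
    + destruct IH as (n & x & Ns & HNs & E); [reflexivity|].
      assert (E' : ALam (eBT M) = alams (S n) (aapps (AVar x) Ns))
        by now rewrite E.
      repeat split; [|discriminate|].
      * rewrite E'. now constructor.
      * intros _. eauto.
    + repeat split; [constructor|discriminate..].
  - destruct (neutral P).
    + destruct IHP as (x & Ns & HNs & E); [reflexivity|].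
      assert (E' : AApp (eBT P) (eBT Q) = aapps (AVar x) (Ns ++ [eBT Q]))
        by (unfold aapps; rewrite fold_left_app; simpl; now rewrite E).
      assert (HNs' : Forall elementary (Ns ++ [eBT Q]))
        by (apply Forall_app; auto).
      repeat split.
      * rewrite E'. now apply (elem_hnf 0).
      * eauto.
      * intros _. exists 0. eauto.
    + repeat split; [constructor|discriminate..].
  - repeat split; [now constructor|discriminate..].
Qed.

(** * Head evaluation on the side of terms *)

Definition taylor_limit (M : term) (t : rterm) : Prop :=
  exists n, taylor (eBT (Nat.iter n head_red M)) t.

(** Smaller approximants have smaller Taylor supports, and each [eBT] of an iterate is itself
    elementary, so these approximants give the whole union. *)
Lemma taylor_BT_limit M t : taylor_BT M t <-> taylor_limit M t.
Proof.
  split.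
  - intros (B & (_ & n & Hle) & HB). exists n. eapply taylor_le; eassumption.
  - intros [n Hn]. eexists. split; [|exact Hn].
    split; [apply elementary_eBT|]. exists n. constructor.
Qed.

Lemma neutral_head_red M : neutral M = true -> neutral (head_red M) = true.
Proof.
  induction M as [x| |P IHP Q IHQ|]; try discriminate; [auto|].
  intros HM. destruct (head_red_app P Q) as [(? & ? & ->)|[(? & ->)|E]];
    try discriminate. rewrite E. now apply IHP.
Qed.

Lemma hnf_head_red M : hnf M = true -> hnf (head_red M) = true.
Proof.
  induction M as [x|M IH|P IHP Q IHQ|]; try discriminate; [auto| |]; intros HM.
  - destruct (head_red_lam M) as [(? & ? & ->)|E]; [discriminate|].
    rewrite E. now apply IH.
  - apply neutral_hnf. now apply neutral_head_red.
Qed.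

(** On a head normal form, [head_red] keeps the head and acts only in the arguments, so what [eBT]
    already shows persists. *)
Lemma taylor_eBT_head_red M t : taylor (eBT M) t -> taylor (eBT (head_red M)) t.
Proof.
  revert t. induction M as [x|M IH|P IHP Q IHQ|P IHP Q IHQ]; intros t H.
  - exact H.
  - simpl in H. destruct (hnf M) eqn:HM; inv H.
    destruct (head_red_lam M) as [(? & ? & ->)|E]; [discriminate|].
    rewrite E. simpl. rewrite hnf_head_red by assumption. constructor. auto.
  - simpl in H. destruct (neutral P) eqn:HP; inv H.
    destruct (head_red_app P Q) as [(? & ? & ->)|[(? & ->)|E]]; try discriminate.
    rewrite E, HP. simpl. rewrite neutral_head_red by assumption.
    constructor; [auto|]. eapply Forall_impl; [|eassumption]. auto.
  - inv H; simpl; constructor; auto.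
Qed.

Lemma taylor_eBT_mono n m M t :
  n <= m -> taylor (eBT (Nat.iter n head_red M)) t ->
  taylor (eBT (Nat.iter m head_red M)) t.
Proof.
  induction 1; [trivial|]. intros Ht. simpl. apply taylor_eBT_head_red. auto.
Qed.

Lemma iter_head_red_plus n P Q :
  Nat.iter n head_red (Plus P Q) =
  Plus (Nat.iter n head_red P) (Nat.iter n head_red Q).
Proof. induction n as [|n IH]; [reflexivity|]. simpl. now rewrite IH. Qed.

Lemma taylor_limit_inl P Q t :
  taylor_limit P t -> taylor_limit (Plus P Q) (RInl t).
Proof. intros [n Hn]. exists n. rewrite iter_head_red_plus. now constructor. Qed.

Lemma taylor_limit_inr P Q t :
  taylor_limit Q t -> taylor_limit (Plus P Q) (RInr t).
Proof. intros [n Hn]. exists n. rewrite iter_head_red_plus. now constructor. Qed.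

Lemma taylor_limit_head_red M t :
  taylor_limit (head_red M) t -> taylor_limit M t.
Proof. intros [n Hn]. exists (S n). now rewrite Nat.iter_succ_r. Qed.

(** Lexicographic induction on the number of iterations and on [M]. If [M] is a choice, one more
    [head_red] step pulls it out of the abstraction, which leaves smaller terms with the same number
    of iterations; otherwise [head_red] commutes with the abstraction and an iteration is
    consumed. *)
Lemma taylor_limit_lam M t :
  taylor_limit M t -> taylor_limit (Lam M) (rlam_nf t).
Proof.
  intros [n Hn]. revert M t Hn. induction n as [|n IHn]; intros M t.
  - revert t. induction M as [x|M _|P _ Q _|P IHP Q IHQ]; intros t H.
    4: { apply taylor_limit_head_red.
         inv H; [apply taylor_limit_inl|apply taylor_limit_inr]; auto. }
    all: exists 0; simpl in *.
    + inv H. repeat constructor.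
    + destruct (hnf M); inv H. repeat constructor. assumption.
    + destruct (neutral P) eqn:HP; inv H. simpl. constructor.
      now constructor.
  - rewrite Nat.iter_succ_r. revert t.
    induction M as [x|M _|P _ Q _|P IHP Q IHQ]; intros t H.
    4: { apply taylor_limit_head_red. simpl in H. rewrite iter_head_red_plus in H.
         inv H; [apply taylor_limit_inl|apply taylor_limit_inr]; auto. }
    all: apply taylor_limit_head_red; now apply IHn.
Qed.

Lemma iter_head_red_apps_var n x Qs :
  Nat.iter n head_red (apps (Var x) Qs) =
  apps (Var x) (map (Nat.iter n head_red) Qs).
Proof.
  induction n as [|n IH]; simpl; [now rewrite map_id|].
  rewrite IH, head_red_apps_neutral, map_map by reflexivity. reflexivity.
Qed.

Definition taylor_stack (As : list approx) (tss : list (list rterm)) : Prop :=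
  Forall2 (fun A ts => Forall (taylor A) ts) As tss.

Lemma taylor_aapps A s As tss :
  taylor A s -> taylor_stack As tss -> taylor (aapps A As) (rapps s tss).
Proof.
  intros Hs H. revert A s Hs. induction H as [|B ts As tss HB _ IH]; [trivial|].
  intros A s Hs. apply (IH (AApp A B) (RApp s ts)). now constructor.
Qed.

Lemma head_red_apps_app M N Qs :
  neutral M = false ->
  head_red (apps M (N :: Qs)) = apps (head_red (App M N)) Qs.
Proof. intros HM. now apply (head_red_apps M N Qs). Qed.

(** The choice crosses one argument per [head_red] step. *)
Lemma taylor_limit_plus_apps P Q Ns t :
  taylor_limit (Plus (apps P Ns) (apps Q Ns)) t ->
  taylor_limit (apps (Plus P Q) Ns) t.
Proof.
  revert P Q. induction Ns as [|N Ns IH]; intros P Q H; [exact H|].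
  apply taylor_limit_head_red. rewrite head_red_apps_app by reflexivity.
  now apply IH.
Qed.

(** The term [apps M Ns] follows the machine: beta and choice transitions are matched by [head_red]
    steps, and the arguments of a head variable evolve in parallel. *)
Lemma ev_taylor_limit :
  (forall s tss t, ev s tss t -> forall (M : term) Ns,
     taylor M s -> taylor_stack (map approx_of_term Ns) tss ->
     taylor_limit (apps M Ns) t) /\
  (forall tss uss, ev_stack tss uss -> forall Ns,
     taylor_stack (map approx_of_term Ns) tss -> exists n,
     taylor_stack (map (fun N => eBT (Nat.iter n head_red N)) Ns) uss) /\
  (forall ts us, ev_bag ts us -> forall N : term, Forall (taylor N) ts -> exists n,
     Forall (taylor (eBT (Nat.iter n head_red N))) us).
Proof.
  apply ev_mutind.
  - intros x tss uss _ IH M Ns HM HNs. destruct M; inv HM.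
    destruct (IH _ HNs) as [n Hn]. exists n.
    rewrite iter_head_red_apps_var.
    change (apps (Var x) ?l) with (lams 0 (apps (Var x) l)).
    rewrite eBT_hnf, map_map.
    apply (taylor_aapps (AVar x)); [constructor|exact Hn].
  - intros s ts tss t _ IH M Ns HM HNs. destruct M as [| |P Q|]; inv HM.
    apply (IH P (Q :: Ns)); [assumption|]. constructor; assumption.
  - intros s t _ IH M Ns HM HNs. destruct M as [|M| |]; inv HM.
    destruct Ns; inv HNs. apply taylor_limit_lam.
    apply (IH M []); [assumption|constructor].
  - intros s ts tss r t Hs _ IH M Ns HM HNs. destruct M as [|M| |]; inv HM.
    destruct Ns as [|N Ns]; inv HNs. apply taylor_limit_head_red.
    rewrite head_red_apps_app by reflexivity.
    apply IH; [|assumption]. simpl. eapply taylor_lsub; eassumption.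
  - intros s tss t _ IH M Ns HM HNs. destruct M as [| | |P Q]; inv HM.
    apply taylor_limit_plus_apps, taylor_limit_inl. auto.
  - intros s tss t _ IH M Ns HM HNs. destruct M as [| | |P Q]; inv HM.
    apply taylor_limit_plus_apps, taylor_limit_inr. auto.
  - intros Ns HNs. destruct Ns; inv HNs. exists 0. constructor.
  - intros ts us tss uss _ IH1 _ IH2 Ns HNs. destruct Ns as [|N Ns]; inv HNs.
    destruct (IH1 N) as [n Hn]; [assumption|].
    destruct (IH2 Ns) as [m Hm]; [assumption|].
    (* All bags need one common number of iterations; monotonicity allows waiting for the
       slowest. *)
    exists (max n m). constructor.
    + eapply Forall_impl; [|exact Hn]. intros u.
      apply taylor_eBT_mono. lia.
    + clear - Hm. unfold taylor_stack in *. revert uss Hm.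
      induction Ns as [|N' Ns IH]; intros uss Hm; inv Hm; constructor; auto.
      eapply Forall_impl; [|eassumption]. intros u.
      apply taylor_eBT_mono. lia.
  - intros N _. exists 0. constructor.
  - intros ts t l u us P _ IH1 _ IH2 N HN.
    rewrite P in HN. inv HN.
    destruct (IH1 N []) as [n Hn]; [assumption|constructor|].
    destruct (IH2 N) as [m Hm]; [assumption|].
    exists (max n m). constructor.
    + revert Hn. apply taylor_eBT_mono. lia.
    + eapply Forall_impl; [|exact Hm]. intros v.
      apply taylor_eBT_mono. lia.
Qed.

Theorem theorem4p10 (M : term) (t : rterm) :
  taylor_BT M t <-> NF_set (taylor M) t.
Proof.
  rewrite taylor_BT_limit. split.
  - intros [n Hn].
    destruct (taylor_iter_head_red n M t (taylor_eBT _ _ Hn)) as (e & He & Het).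
    destruct (pick_steps_NF e t Het (taylor_eBT_normal _ _ Hn)) as (F & HF & Ht).
    exists e, F. repeat split; [exact He|apply HF..|].
    apply Exists_exists. exists t. split; [exact Ht|reflexivity].
  - intros (e & F & He & HF & Ht).
    apply (proj1 ev_taylor_limit e [] t (is_NF_ev e F t HF Ht) M []);
      [exact He|constructor].
Qed.
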